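(* Assume (A1), and assume (C3) holds for some $p>2$. Let $a>0$ and set $$v_n=\frac{n^a}{(nh_n)^{d/2}},\qquad \theta=\frac{2a(d+p)-d^2}{d(3d+2)}.$$ If $\theta>0$ and $h_n\ge n^{-\theta}$ for all $n$, then $$\Big\|\sup_{x\in[0,1]^d}|g_n(x)-Eg_n(x)|\Big\|_p=O[v_n],$$ where $\|\cdot\|_p$ is the $L^p(\mathbb P)$ norm and $O[\cdot]$ is the usual deterministic big-O as $n\to\infty$.
   Context: Fix an integer $d\ge1$. For $x=(x_1,\dots,x_d)\in\mathbb{R}^d$ let $\|x\|=\max_{1\le k\le d}|x_k|$; for $i,j\in\mathbb{Z}^d$ let $|i-j|=\max_{1\le l\le d}|i_l-j_l|$, and $|k|=|k-0|$. Let $(\varepsilon_i)_{i\in\mathbb{Z}^d}$ be a strictly stationary real random field on a probability space $(\Omega,\mathcal F,\mathbb P)$ with $E\varepsilon_0=0$. Strict stationarity means: for all $k\in\mathbb{Z}^d$, $n\ge1$ and $i_1,\dots,i_n\in\mathbb{Z}^d$, the vectors $(\varepsilon_{i_1},\dots,\varepsilon_{i_n})$ and $(\varepsilon_{i_1+k},\dots,\varepsilon_{i_n+k})$ have the same law. Let $g:[0,1]^d\to\mathbb{R}$ and $\Lambda_n=\{1,\dots,n\}^d$, and set $Y_i=g(i/n)+\varepsilon_i$ for $i\in\Lambda_n$. Let $K$ be a probability density on $\mathbb{R}^d$ and $(h_n)_{n\ge1}$ positive numbers with $h_n\to0$ and $nh_n\to\infty$. For $x\in[0,1]^d$ define $$g_n(x)=\frac{\sum_{i\in\Lambda_n}Y_i\,K\big((x-i/n)/h_n\big)}{\sum_{i\in\Lambda_n}K\big((x-i/n)/h_n\big)}.$$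 Assumption (A1): $K$ is symmetric and nonnegative, and supported in $[-1,1]^d$. There is $\eta>0$ with $|K(x)-K(y)|\le\eta\|x-y\|$ for all $x,y\in[-1,1]^d$, and there are constants $c,C>0$ with $c\le K(x)\le C$ for all $x\in[-1,1]^d$. Dependence notation: $i<_{lex}j$ for distinct $i,j\in\mathbb{Z}^d$ means either $i_1<j_1$, or for some $p\in\{2,\dots,d\}$ one has $i_p<j_p$ and $i_q=j_q$ for $1\le q<p$. Set $V_i^1=\{j\in\mathbb{Z}^d: j<_{lex}i\}$ and, for integers $m\ge2$, $V_i^m=V_i^1\cap\{j:|i-j|\ge m\}$. For $\Gamma\subset\mathbb{Z}^d$ let $\mathcal F_\Gamma=\sigma(\varepsilon_j: j\in\Gamma)$. For $k\in V_0^1$ (so $|k|\ge1$) put $E_{|k|}(\varepsilon_0)=E(\varepsilon_0\mid\mathcal F_{V_0^{|k|}})$. Condition (C3) (for a given $p>2$): $\varepsilon_0\in L^p$ and $\sum_{k\in V_0^1}\|\varepsilon_kE_{|k|}(\varepsilon_0)\|_{p/2}<\infty$. *)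

(* Defs.v *)
From HB Require Import structures.
From mathcomp Require Import all_boot all_order all_algebra.
From mathcomp Require Import all_classical all_reals all_analysis.
Set Implicit Arguments. Unset Strict Implicit. Unset Printing Implicit Defensive.
Import Order.TTheory GRing.Theory Num.Theory.
Import numFieldNormedType.Exports.
Local Open Scope classical_set_scope.
Local Open Scope ring_scope.

Definition zabs (d : nat) (k : 'rV[int]_d) : nat := (\max_(l < d) `|k ord0 l|%N)%N.

Definition lexlt (d : nat) (i j : 'rV[int]_d) : Prop :=
  exists p : 'I_d, (i ord0 p < j ord0 p)%R /\
    forall q : 'I_d, (q < p)%N -> i ord0 q = j ord0 q.

(* V_i^m = {j : j <_lex i, |i - j| >= m}; for m = 1 the second condition is
   automatic (j <_lex i implies j <> i), so Vset i 1 = V_i^1. *)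
Definition Vset (d : nat) (i : 'rV[int]_d) (m : nat) : set 'rV[int]_d :=
  [set j | lexlt j i /\ (m <= zabs (i - j))%N].

Definition supnorm (R : realType) (d : nat) (x : 'rV[R]_d) : R :=
  \big[Num.max/0]_(l < d) `|x ord0 l|.

Definition cube11 (R : realType) (d : nat) (x : 'rV[R]_d) : Prop :=
  forall l : 'I_d, -1 <= x ord0 l <= 1.

Definition cube01 (R : realType) (d : nat) (x : 'rV[R]_d) : Prop :=
  forall l : 'I_d, 0 <= x ord0 l <= 1.

Definition rext (R : realType) (n : nat) (y : 'rV[R]_n) (t : R) : 'rV[R]_n.+1 :=
  \row_(i < n.+1) (if unlift ord_max i is Some j then y ord0 j else t).

(* iterated Lebesgue integral over R^n (Lebesgue integral on R^n for nonnegative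
   measurable integrands, by Tonelli) *)
Fixpoint iint (R : realType) (n : nat) : ('rV[R]_n -> \bar R) -> \bar R :=
  match n with
  | 0 => fun F => F 0
  | n'.+1 => fun F =>
      (\int[@lebesgue_measure R]_t iint (fun y => F (rext y t)))%E
  end.

Definition prob_density (R : realType) (d : nat) (K : 'rV[R]_d -> R) : Prop :=
  (forall x, 0 <= K x) /\ iint (fun x => (K x)%:E) = 1%E.

Definition assumption_A1 (R : realType) (d : nat) (K : 'rV[R]_d -> R) : Prop :=
  [/\ (forall x, K (- x) = K x),
      (forall x, 0 <= K x),
      (forall x, ~ cube11 x -> K x = 0),
      (exists eta : R, 0 < eta /\
         forall x y, cube11 x -> cube11 y ->
           `|K x - K y| <= eta * supnorm (x - y)) &
      (exists c C : R, [/\ 0 < c, 0 < C &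
         forall x, cube11 x -> c <= K x <= C])].

Section Field.
Context {dT : measure_display} {T : measurableType dT} {R : realType}.
Variable P : probability T R.
Variable d : nat.

(* strict stationarity: all finite-dimensional distributions are shift
   invariant (equality of laws on R^n, tested on measurable rectangles) *)
Definition strictly_stationary (eps : 'rV[int]_d -> T -> R) : Prop :=
  forall (k : 'rV[int]_d) (n : nat) (i : 'I_n -> 'rV[int]_d)
         (B : 'I_n -> set R),
    (forall j, measurable (B j)) ->
    P [set w | forall j, B j (eps (i j) w)] =
    P [set w | forall j, B j (eps (i j + k) w)].

Definition gen_sigma (eps : 'rV[int]_d -> T -> R) (G : set 'rV[int]_d)
    : set (set T) :=
  <<s [set A | exists j, G j /\ exists B : set R, measurable B /\
                 A = eps j @^-1` B] >>.

Definition is_cond_exp (F : set (set T)) (X Y : T -> R) : Prop :=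
  [/\ (forall B : set R, measurable B -> F (Y @^-1` B)),
      P.-integrable setT (EFin \o Y) &
      (forall A, F A ->
         (\int[P]_(w in A) (Y w)%:E = \int[P]_(w in A) (X w)%:E)%E)].

(* Condition (C3) for exponent p. Y m is (a version of) E_m(eps_0) =
   E(eps_0 | F_{V_0^m}); the L^{p/2} norms do not depend on the version. *)
Definition condition_C3 (eps : 'rV[int]_d -> T -> R) (p : R) : Prop :=
  (Lnorm P p%:E (EFin \o eps (0%R : 'rV[int]_d)) < +oo)%E /\
  exists Y : nat -> T -> R,
    (forall m, (1 <= m)%N -> is_cond_exp (gen_sigma eps (Vset (0%R : 'rV[int]_d) m)) (eps (0%R : 'rV[int]_d)) (Y m)) /\
    (esum (Vset (0%R : 'rV[int]_d) 1) (fun k =>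
        Lnorm P (p / 2)%:E (fun w => (eps k w * Y (zabs k) w)%:E)) < +oo)%E.

Definition grid_pt (n : nat) (i : {ffun 'I_d -> 'I_n}) : 'rV[R]_d :=
  \row_l (((i l).+1)%:R / n%:R).
Definition grid_idx (n : nat) (i : {ffun 'I_d -> 'I_n}) : 'rV[int]_d :=
  \row_l (((i l).+1)%:Z).

Definition estimator (K : 'rV[R]_d -> R) (g : 'rV[R]_d -> R)
    (eps : 'rV[int]_d -> T -> R) (n : nat) (hn : R) (x : 'rV[R]_d) (w : T) : R :=
  (\sum_(i : {ffun 'I_d -> 'I_n})
      (g (grid_pt i) + eps (grid_idx i) w) * K (hn^-1 *: (x - grid_pt i)))
  / (\sum_(i : {ffun 'I_d -> 'I_n}) K (hn^-1 *: (x - grid_pt i))).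

Definition sup_dev (K : 'rV[R]_d -> R) (g : 'rV[R]_d -> R)
    (eps : 'rV[int]_d -> T -> R) (n : nat) (hn : R) (w : T) : \bar R :=
  ereal_sup [set (`| (estimator K g eps n hn x w)%:E
                      - 'E_P[estimator K g eps n hn x] |)%E
             | x in [set x | cube01 x]].

End Field.

(* Main.v *)
(* The deviation at x is a weighted sum of the eps_i over a box of about (nh)^d
   sites, divided by a weight sum of order at least (nh)^d.

   Moment inequality.  For finitely many sites,
   E|sum a_i eps_i|^p <= (D sum a_i^2)^(p/2): remove the lexicographically largest
   site i and expand |S + a_i eps_i|^p to second order around S.  In the first-order
   term E[eps_i psi(S)], with psi(x) = x|x|^(p-2), peel off the sites k of S from the
   nearest to i to the farthest: the increment of psi only involves sites at distance
   at least |k - i| from i, so after a translation by -i condition (C3) replaces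
   eps_i by its conditional expectation, and Hoelder's inequality bounds the term.

   Supremum.  K may jump at the boundary of [-1,1]^d, so the weights are not
   Lipschitz in x.  Extend K to a Lipschitz function by clamping and write the weight
   at x as (clamped kernel at the nearest point y of a mesh of step 1/M) * (indicator
   of the window of x), up to an error eta/(Mh) on each site of the window.  Each of
   the d one-dimensional window indicators is a signed sum of indicators of dyadic
   intervals, two per length 2^j with 2^j = O(nh).  For each vector of lengths, the
   supremum over x is thus at most the l^p norm over all mesh points and dyadic
   boxes; since p > 2 the sum over lengths is dominated by the largest ones, and the
   total is O(M^(d/p) (nh)^(d/2)).  With M = n^(ap/d) the factor M^(d/p) is n^a, and
   h_n >= n^(-theta) makes the error term smaller than the main one. *)
Require Import Defs.
From HB Require Import structures.
From mathcomp Require Import all_boot all_order all_algebra.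
From mathcomp Require Import all_classical all_reals all_analysis.
From mathcomp Require Import measurable_realfun.
From mathcomp Require Import ring lra zify.
Import Order.TTheory GRing.Theory Num.Theory.
Import numFieldNormedType.Exports.
Local Open Scope classical_set_scope.
Local Open Scope ring_scope.

Set Implicit Arguments.
Unset Strict Implicit.

(** * Inequalities for real powers *)

(* Derivative of |x| ^ (q + 2) up to the factor q + 2. *)
Definition spow {R : realType} (q x : R) : R := x * `|x| `^ q.

Lemma le_powR {R : realType} (r x y : R) : 0 <= r -> 0 <= x -> x <= y ->
  x `^ r <= y `^ r.
Proof.
by move=> r0 x0 xy; apply: ge0_ler_powR; rewrite ?nnegrE// (le_trans x0).
Qed.

(** Young's inequality for [z] and [u ^ (r - 1)], with conjugate exponents [r] and [r / (r - 1)],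
    rearranges into the tangent-line inequality of [t ^ r] at [u]. *)
Lemma powR_tangent {R : realType} (z u r : R) : 0 <= z -> 0 <= u -> 1 < r ->
  u `^ r + r * u `^ (r - 1) * (z - u) <= z `^ r.
Proof.
move=> z0 u0 r1.
have r0 : 0 < r by lra.
have rr : r - 1 != 0 by apply/eqP; lra.
have := @conjugate_powR R z (u `^ (r - 1)) r (r / (r - 1)) z0 (powR_ge0 _ _) r0.
rewrite divr_gt0 ?subr_gt0// -powRrM.
have -> : (r - 1) * (r / (r - 1)) = r by field; rewrite rr.
move=> /(_ isT).
have -> : r^-1 + (r / (r - 1))^-1 = 1 by field; rewrite rr (gt_eqF r0).
move=> /(_ erefl) H.
have E := mulr_powRB1 u0 r0.
rewrite -(ler_pM2l r0) in H.
have E2 : r * (z `^ r / r + u `^ r / (r / (r - 1))) = z `^ r + (r - 1) * u `^ r.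
  by field; rewrite rr (gt_eqF r0).
rewrite E2 in H.
rewrite mulrBr -[r * _ * u]mulrA [_ * u]mulrC E; lra.
Qed.

(** With [|y| <= |x|], the difference is [(x - y) |x|^q + y (|x|^q - |y|^q)]; the tangent of
    [t ^ (q + 1)] at [|x|] bounds the second term by [q |x - y| |x|^q]. *)
Lemma spow_lipschitz {R : realType} (q x y : R) : 0 < q ->
  `|spow q x - spow q y| <= (q + 1) * `|x - y| * (`|x| `^ q + `|y| `^ q).
Proof.
move=> q0; wlog xy : x y / `|y| <= `|x|.
  move=> H; have [|/ltW] := leP `|y| `|x|; first exact: H.
  by move/H; rewrite distrC [`|y - x|]distrC [`|y| `^ q + _]addrC.
have E : spow q x - spow q y = (x - y) * `|x| `^ q + y * (`|x| `^ q - `|y| `^ q).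
  by rewrite /spow; ring.
have le_pow : `|y| `^ q <= `|x| `^ q by apply: le_powR => //; exact: ltW.
have T : `|x| `^ (q + 1) + (q + 1) * `|x| `^ q * (`|y| - `|x|) <= `|y| `^ (q + 1).
  have := @powR_tangent R `|y| `|x| (q + 1) (normr_ge0 _) (normr_ge0 _).
  by rewrite addrK; apply; lra.
have mE (z : R) : `|z| `^ (q + 1) = `|z| * `|z| `^ q.
  by rewrite -(@mulr_powRB1 _ _ (q + 1)) ?addrK//; lra.
rewrite !mE in T.
rewrite E; apply: (le_trans (ler_normD _ _)); rewrite !normrM.
rewrite (ger0_norm (powR_ge0 _ _)).
have Epow : `| `|x| `^ q - `|y| `^ q | = `|x| `^ q - `|y| `^ q.
  by rewrite ger0_norm ?subr_ge0.
rewrite Epow.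
have D : `|x| - `|y| <= `|x - y| by rewrite lerB_dist.
have X0 := powR_ge0 `|x| q; have Y0 := powR_ge0 `|y| q.
have N0 := normr_ge0 (x - y).
have H1 : `|x| `^ q * (`|x| - `|y|) <= `|x| `^ q * `|x - y| by rewrite ler_wpM2l.
have H2 : 0 <= `|x - y| * `|y| `^ q by rewrite mulr_ge0.
have H3 := ler_wpM2l (ltW q0) H1.
have H4 := mulr_ge0 (ltW q0) H2.
move: T H1 H2 H3 H4; move: (`|x| `^ q) (`|y| `^ q) (`|x - y|) => A B N; lra.
Qed.

Lemma spow_abs {R : realType} (q x : R) : 0 < q -> spow q x * x = `|x| `^ (q + 2).
Proof.
move=> q0; rewrite /spow mulrAC -expr2 -real_normK ?num_real// -powR_mulrn//.
by rewrite -powRD 1?addrC//; apply/implyP => /eqP; lra.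
Qed.

Lemma norm_spow {R : realType} (q x : R) : 0 < q -> `|spow q x| = `|x| `^ (q + 1).
Proof.
move=> q0; rewrite /spow normrM (ger0_norm (powR_ge0 _ _)) -(@mulr_powRB1 _ _ (q + 1)) ?addrK//.
by lra.
Qed.

Lemma powRD_le {R : realType} (q x y : R) : 0 < q -> 0 <= x -> 0 <= y ->
  (x + y) `^ q <= 2 `^ q * (x `^ q + y `^ q).
Proof.
move=> q0; wlog xy : x y / y <= x.
  move=> H x0 y0; have [|/ltW] := leP y x; first by move=> ?; exact: H.
  by move=> /H; rewrite addrC [_ `^ q + _]addrC; apply.
move=> x0 y0; apply: (@le_trans _ _ ((2 * x) `^ q)).
  by apply: le_powR; lra.
by rewrite powRM// ler_wpM2l ?powR_ge0// lerDl powR_ge0.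
Qed.

(** The tangent inequality at [|x + y|] yields the first-order term with [spow] taken at [x + y];
    the Lipschitz bound moves it to [x], at the cost of the second-order term. *)
Lemma powR_norm_taylor {R : realType} (p x y : R) : 2 < p ->
  `|x + y| `^ p <= `|x| `^ p + p * (spow (p - 2) x * y)
    + p * (p - 1) * (1 + 2 `^ (p - 2)) * (`|x| `^ (p - 2) * y ^+ 2 + `|y| `^ p).
Proof.
move=> p2; set q := p - 2; have q0 : 0 < q by rewrite /q; lra.
have T : `|x + y| `^ p - p * (spow q (x + y) * y) <= `|x| `^ p.
  have := @powR_tangent R `|x| `|x + y| p (normr_ge0 _) (normr_ge0 _).
  have -> : p - 1 = q + 1 by rewrite /q; ring.
  rewrite -norm_spow// => /(_ ltac:(lra)); apply: le_trans.
  rewrite lerD2l -mulrN -mulrA ler_wpM2l//; first lra.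
  have S := @spow_abs _ q (x + y) q0.
  have S2 : `|spow q (x + y)| * `|x + y| = spow q (x + y) * (x + y).
    by rewrite -normrM S ger0_norm// powR_ge0.
  rewrite mulrBr S2.
  have : spow q (x + y) * x <= `|spow q (x + y)| * `|x|.
    by rewrite -normrM ler_norm.
  nra.
have L := @spow_lipschitz _ q (x + y) x q0.
rewrite (_ : x + y - x = y) in L; last by ring.
have A : (spow q (x + y) - spow q x) * y <= (q + 1) * y ^+ 2 * (`|x + y| `^ q + `|x| `^ q).
  apply: (le_trans (ler_norm _)); rewrite normrM -real_normK ?num_real//.
  by have := normr_ge0 y; nra.
have B : `|x + y| `^ q <= 2 `^ q * (`|x| `^ q + `|y| `^ q).
  apply: (@le_trans _ _ ((`|x| + `|y|) `^ q)); last exact: powRD_le.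
  by apply: le_powR; [exact: ltW| |exact: ler_normD].
have C : y ^+ 2 * `|y| `^ q = `|y| `^ p.
  rewrite -real_normK ?num_real// -powR_mulrn// -powRD.
    by congr powR; rewrite /q; ring.
  by apply/implyP => /eqP; rewrite /q; lra.
have y2 := sqr_ge0 y.
have D : y ^+ 2 * (`|x + y| `^ q + `|x| `^ q) <=
   (1 + 2 `^ q) * (`|x| `^ q * y ^+ 2 + `|y| `^ p).
  rewrite -C.
  have : y ^+ 2 * (`|x + y| `^ q) <= y ^+ 2 * (2 `^ q * (`|x| `^ q + `|y| `^ q)).
    by rewrite ler_wpM2l.
  have : 0 <= y ^+ 2 * `|y| `^ q by rewrite mulr_ge0// powR_ge0.
  have := powR_ge0 (2 : R) q.
  nra.
have -> : p - 1 = q + 1 by rewrite /q; ring.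
have F : (q + 1) * (y ^+ 2 * (`|x + y| `^ q + `|x| `^ q)) <=
   (q + 1) * ((1 + 2 `^ q) * (`|x| `^ q * y ^+ 2 + `|y| `^ p)).
  by rewrite ler_wpM2l//; lra.
have G : p * ((spow q (x + y) - spow q x) * y) <= p * ((q + 1) * ((1 + 2 `^ q) * (`|x| `^ q * y ^+ 2 + `|y| `^ p))).
  by rewrite ler_wpM2l//; lra.
move: T G; move: (`|x| `^ q * y ^+ 2 + _) (2 `^ q) (spow q x) (spow q (x + y)) => W c s s'.
move: (`|x + y| `^ p) (`|x| `^ p) => a b T G.
have -> : p * (q + 1) * (1 + c) * W = p * ((q + 1) * ((1 + c) * W)) by ring.
move: T G; move: ((q + 1) * ((1 + c) * W)) => V.
rewrite (_ : p * ((s' - s) * y) = p * (s' * y) - p * (s * y)); last by ring.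
lra.
Qed.

(* The Gronwall step of the moment induction. *)
Lemma powR_step {R : realType} (q b e C1 C2 D : R) : 1 < q -> 0 <= b -> 0 <= e ->
  0 <= C1 -> 0 <= C2 -> 1 <= D -> C1 * 2 <= q * D -> C2 * 2 <= D ->
  b `^ q + C1 * e * b `^ (q - 1) + C2 * e `^ q <= (b + D * e) `^ q.
Proof.
move=> q1 b0 e0 C10 C20 D1 HC1 HC2.
have De0 : 0 <= D * e by rewrite mulr_ge0//; lra.
have T1 := @powR_tangent R (b + D * e) b q (addr_ge0 b0 De0) b0 q1.
have T2 : b `^ q + (D * e) `^ q <= (b + D * e) `^ q.
  rewrite -!(@mulr_powRB1 _ _ q) ?addr_ge0//; try lra.
  rewrite mulrDl lerD// ler_wpM2l//; apply: le_powR; lra.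
have Dq : D * e `^ q <= (D * e) `^ q.
  rewrite powRM//; last lra.
  by rewrite ler_wpM2r ?powR_ge0// le1r_powR// ltW.
have eq0 := powR_ge0 e q; have bq0 := powR_ge0 b (q - 1).
have eb : 0 <= e * b `^ (q - 1) by rewrite mulr_ge0.
(* Half the sum of [T1] and [T2], with [D e^q <= (D e)^q]; the halving explains the factors 2 in the
   hypotheses on [C1] and [C2]. *)
nra.
Qed.

(** * Stationary fields and conditional expectations *)

(** Finite-dimensional rectangles: a pi-system generating the product sigma-algebra on the path
    space. *)
Definition cylinders (I : choiceType) (R : realType) : set (set (I -> R)) :=
  [set A | exists (s : seq I) (B : I -> set R), (forall i, measurable (B i)) /\
     A = [set f | forall i, i \in s -> B i (f i)]].

Arguments cylinders : clear implicits.

Definition paths (I : choiceType) (R : realType) : measurableType (cylinders I R).-sigma :=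
  g_sigma_algebraType (cylinders I R).

Lemma cylinders_setI (I : choiceType) (R : realType) : setI_closed (cylinders I R).
Proof.
move=> _ _ [s [B [mB ->]]] [s' [B' [mB' ->]]].
exists (s ++ s'), (fun i => (if i \in s then B i else setT) `&`
   (if i \in s' then B' i else setT)); split.
  by move=> i; apply: measurableI; case: ifP.
apply/seteqP; split=> [f [/= Hs Hs'] i|f /= H].
  by rewrite mem_cat => _; split; case: ifP => // /[dup]; [move=> _ /Hs|move=> _ /Hs'].
split=> i i_s.
  by have := H i; rewrite mem_cat i_s/= => /(_ isT) [].
by have := H i; rewrite mem_cat i_s orbT => /(_ isT) [].
Qed.

Lemma measurable_coord (I : choiceType) (R : realType) (i : I) :
  measurable_fun setT (fun f : paths I R => f i : R).
Proof.
move=> _ B mB; rewrite setTI; apply: sub_sigma_algebra.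
exists [:: i], (fun=> B); split=> //; apply/seteqP; split=> f /=.
  by move=> Bf j; rewrite inE => /eqP ->.
by apply; rewrite inE.
Qed.

Section Stationary.
Context {d : nat} {dT : measure_display} {T : measurableType dT} {R : realType}.
Variables (P : probability T R) (eps : 'rV[int]_d -> T -> R).
Hypothesis meps : forall i, measurable_fun setT (eps i).
Hypothesis stat : strictly_stationary P eps.

(** The translated field as a single random element of path space, so that stationarity becomes an
    equality of image measures. *)
Definition shifted (k : 'rV[int]_d) (w : T) : paths 'rV[int]_d R := fun j => eps (j + k) w.

Lemma measurable_shifted k : measurable_fun setT (shifted k).
Proof.
apply: (@measurability _ _ T (paths 'rV[int]_d R) setT (shifted k) (cylinders 'rV[int]_d R)) => // _ [_ [s [B [mB ->]]] <-].
rewrite setTI (_ : _ @^-1` _ = \big[setI/setT]_(i <- s) (eps (i + k) @^-1` B i)).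
  apply: bigsetI_measurable => i _; rewrite -[X in measurable X]setTI.
  exact: meps.
rewrite -bigcap_seq; apply/seteqP; split=> w /= H i /=; exact: H.
Qed.

HB.instance Definition _ k := isMeasurableFun.Build _ _ _ _ (shifted k) (measurable_shifted k).

(** Stationarity gives agreement of the two laws on cylinders, and uniqueness of finite measures on
    a generating pi-system extends it to all measurable sets of paths. *)
Lemma shifted_law k (A : set (paths 'rV[int]_d R)) : measurable A ->
  distribution P (shifted k) A = distribution P (shifted 0) A.
Proof.
move=> mA.
apply: (@measure_unique _ R (paths _ R) (cylinders 'rV[int]_d R) (fun=> setT) erefl
  (@cylinders_setI _ R) _ _ (distribution P (shifted k)) (distribution P (shifted 0))) => //.
- by move=> _; exists [::], (fun=> setT); split=> //; apply/seteqP; split.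
- by rewrite bigcup_const//; exists 0%N.
- move=> _ [s [B [mB ->]]].
  (* Enumerating the list [s] by ordinals puts the cylinder into the form used by
     [strictly_stationary]. *)
  have E l : distribution P (shifted l) [set f | forall i, i \in s -> B i (f i)] =
      P [set w | forall j : 'I_(size s), B (s`_j) (eps (s`_j + l) w)].
    rewrite /distribution /pushforward; congr (P _).
    apply/seteqP; split=> w /= H.
      by move=> j; apply: H; apply: mem_nth.
    move=> i /(nthP 0) [j js <-]; exact: (H (Ordinal js)).
  have S l := @stat l (size s) (fun j => s`_j) (fun j => B s`_j) (fun j => mB _).
  exact: (etrans (E k) (etrans (etrans (esym (S k)) (S 0)) (esym (E 0)))).
- by move=> _; rewrite /= probability_setT ltry.
Qed.

Local Open Scope ereal_scope.

Lemma stationary_ge0_integral k (F : paths 'rV[int]_d R -> \bar R) :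
  measurable_fun setT F -> (forall f, 0 <= F f) ->
  \int[P]_w F (shifted k w) = \int[P]_w F (shifted 0 w).
Proof.
move=> mF F0.
rewrite -(ge0_integral_distribution (shifted k) mF F0).
rewrite -(ge0_integral_distribution (shifted 0) mF F0).
by apply: eq_measure_integral => A mA _; exact: shifted_law.
Qed.

Lemma stationary_integral k (F : paths 'rV[int]_d R -> \bar R) :
  measurable_fun setT F ->
  \int[P]_w F (shifted k w) = \int[P]_w F (shifted 0 w).
Proof.
move=> mF; rewrite integralE [RHS]integralE.
have Ep l : ((fun w => F (shifted l w))^\+ = F^\+ \o shifted l) by rewrite -funepos_comp.
have En l : ((fun w => F (shifted l w))^\- = F^\- \o shifted l) by rewrite -funeneg_comp.
rewrite !Ep !En; congr (_ - _).
  exact: (@stationary_ge0_integral k _ (measurable_funepos mF) (funepos_ge0 F)).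
exact: (@stationary_ge0_integral k _ (measurable_funeneg mF) (funeneg_ge0 F)).
Qed.

End Stationary.

Import HBNNSimple.

(** * Conditional expectations tested against measurable multipliers *)

Section CondExp.
Context {dT : measure_display} {T : measurableType dT} {R : realType}.
Variables (P : probability T R) (Gs : set (set T)).
Hypothesis mGs : Gs `<=` measurable.

Local Notation TG := (g_sigma_algebraType Gs).

Lemma sub_measurable (A : set T) : <<s Gs >> A -> measurable A.
Proof. by apply: smallest_sub => //; exact: sigma_algebra_measurable. Qed.

Lemma sub_measurable_fun d' (U : measurableType d') (G : T -> U) :
  measurable_fun [set: TG] (G : TG -> U) -> measurable_fun setT G.
Proof.
move=> mG _ B mB; apply: sub_measurable.
by apply: (mG _ B mB); exact: (@measurableT _ TG).
Qed.

(** A simple function is a combination of indicators of its level sets; this reduces the integral to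
    integrals over sets of the conditioning sigma-algebra, where [is_cond_exp] applies. *)
Lemma integral_mul_nnsfun (Z : T -> R) (f : {nnsfun TG >-> R}) :
  P.-integrable setT (EFin \o Z) ->
  let s := fset_set (range f) in
  (\int[P]_w (Z w * f w)%:E = \sum_(i < size (finmap.enum_fset s))
     ((finmap.enum_fset s)`_i)%:E *
       \int[P]_(w in f @^-1` [set (finmap.enum_fset s)`_i]) (Z w)%:E)%E.
Proof.
move=> iZ s; set r := finmap.enum_fset s.
have mA y : measurable (f @^-1` [set y] : set T).
  by apply: sub_measurable; exact: (@measurable_funPTI _ _ TG R f).
have iZA y : P.-integrable setT (fun w => (Z w * \1_(f @^-1` [set y]) w)%:E).
  have -> : (fun w => (Z w * \1_(f @^-1` [set y]) w)%:E) = (EFin \o Z) \_ (f @^-1` [set y]).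
    by rewrite epatch_indic; apply/funext => w; rewrite /= EFinM.
  apply/(integrable_mkcond _ (mA y)).
  exact: (@integrableS _ T R P setT _ _ measurableT (mA y) (fun _ _ => I) iZ).
have -> : (fun w => (Z w * f w)%:E) = (fun w => \sum_(i < size r)
    (r`_i)%:E * (Z w * \1_(f @^-1` [set r`_i]) w)%:E)%E.
  apply/funext => w; rewrite (fimfunEord f) mulr_sumr sumEFin; congr EFin.
  by apply: eq_bigr => i _; rewrite mulrCA.
rewrite integral_sum//; last by move=> i; exact: integrableZl.
apply: eq_bigr => i _; rewrite integralZl//; congr (_ * _)%E.
rewrite [RHS]integral_mkcond epatch_indic; apply: eq_integral => w _.
by rewrite /= EFinM.
Qed.

(** The identity holds for simple functions increasing to [G]; it passes to the limit by dominated
    convergence, with bounds [|X G|] and [|Y G|]. *)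
Lemma cond_exp_integral_mul_ge0 (X Y G : T -> R) :
  is_cond_exp P <<s Gs >> X Y -> P.-integrable setT (EFin \o X) ->
  measurable_fun [set: TG] (G : TG -> R) -> (forall w, 0 <= G w) ->
  P.-integrable setT (fun w => (X w * G w)%:E) ->
  P.-integrable setT (fun w => (Y w * G w)%:E) ->
  (\int[P]_w (X w * G w)%:E = \int[P]_w (Y w * G w)%:E)%E.
Proof.
move=> [mY iY XY] iX mG G0 iXG iYG.
have mG' : measurable_fun [set: TG] (EFin \o G : TG -> \bar R).
  exact/measurable_EFinP.
pose a := nnsfun_approx (@measurableT _ TG) mG'.
have an n : (\int[P]_w (X w * a n w)%:E = \int[P]_w (Y w * a n w)%:E)%E.
  rewrite !integral_mul_nnsfun//; apply: eq_bigr => i _; congr (_ * _)%E.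
  apply/esym/XY; exact: (@measurable_funPTI _ _ TG R (a n)).
have a_le n w : a n w <= G w.
  have cv := @cvg_nnsfun_approx _ TG R setT measurableT _ mG' (fun x _ => G0 x) w I.
  rewrite -lee_fin; apply: (cvge_to_ge cv); near=> m => /=; rewrite lee_fin.
  have nm : (n <= m)%N by near: m; exact: nbhs_infty_ge.
  by have /lefP := @nd_nnsfun_approx _ TG R setT measurableT _ mG' n m nm; apply.
have cvZ (Z : T -> R) : P.-integrable setT (EFin \o Z) ->
    P.-integrable setT (fun w => (Z w * G w)%:E) ->
    (\int[P]_w (Z w * a n w)%:E)%E @[n --> \oo] --> (\int[P]_w (Z w * G w)%:E)%E.
  move=> iZ iZG.
  have mZ : measurable_fun setT Z by apply/measurable_EFinP; exact: measurable_int iZ.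
  have [] := @dominated_convergence _ T R P setT measurableT
     (fun n w => (Z w * a n w)%:E) (fun w => (Z w * G w)%:E)
     (fun w => `|(Z w * G w)%:E|%E) => //.
  - move=> n; apply/measurable_EFinP/measurable_funM => //.
    by apply: sub_measurable_fun; exact: measurable_funPT.
  - by apply: measurable_int iZG.
  - apply/nearW => w _.
    have cv := @cvg_nnsfun_approx _ TG R setT measurableT _ mG' (fun x _ => G0 x) w I.
    rewrite EFinM; under eq_fun do rewrite EFinM.
    exact: cvgeZl.
  - exact: integrable_abse.
  - apply/nearW => w n _; rewrite lee_fin !normrM ler_wpM2l//.
    by rewrite !ger0_norm.
have := cvZ X iX iXG; have := cvZ Y iY iYG.
under eq_fun do rewrite -an.
by move=> cY cX; exact: cvg_unique cX cY.
Unshelve. all: by end_near. Qed.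

Lemma cond_exp_integral_mul (X Y G : T -> R) :
  is_cond_exp P <<s Gs >> X Y -> P.-integrable setT (EFin \o X) ->
  measurable_fun [set: TG] (G : TG -> R) ->
  P.-integrable setT (fun w => (X w * G w)%:E) ->
  P.-integrable setT (fun w => (Y w * G w)%:E) ->
  (\int[P]_w (X w * G w)%:E = \int[P]_w (Y w * G w)%:E)%E.
Proof.
move=> ceXY iX mG iXG iYG.
have iY : P.-integrable setT (EFin \o Y) by case: ceXY.
pose Gp w := Order.max (G w) 0; pose Gm w := Order.max (- G w) 0.
have GE w : G w = Gp w - Gm w.
  by rewrite /Gp /Gm; case: leP => ?; case: leP => ?; lra.
have mGp : measurable_fun [set: TG] (Gp : TG -> R) by apply: measurable_maxr.
have mGm : measurable_fun [set: TG] (Gm : TG -> R).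
  by apply: measurable_maxr => //; exact: (measurableT_comp (@oppr_measurable R setT)).
have Gp0 w : 0 <= Gp w by rewrite le_max lexx orbT.
have Gm0 w : 0 <= Gm w by rewrite le_max lexx orbT.
have GpG w : Gp w <= `|G w| by rewrite ge_max ler_norm normr_ge0.
have GmG w : Gm w <= `|G w| by rewrite ge_max -normrN ler_norm normr_ge0.
have iH (Z H : T -> R) : P.-integrable setT (EFin \o Z) ->
    P.-integrable setT (fun w => (Z w * G w)%:E) ->
    measurable_fun [set: TG] (H : TG -> R) -> (forall w, 0 <= H w) ->
    (forall w, H w <= `|G w|) ->
    P.-integrable setT (fun w => (Z w * H w)%:E).
  move=> iZ iZG mH H0 HG; apply: le_integrable iZG => //.
    apply/measurable_EFinP/measurable_funM; last exact: sub_measurable_fun.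
    by apply/measurable_EFinP; exact: measurable_int iZ.
  by move=> w _; rewrite lee_fin !normrM ler_wpM2l// ger0_norm.
have E (Z : T -> R) : P.-integrable setT (EFin \o Z) ->
    P.-integrable setT (fun w => (Z w * G w)%:E) ->
    (\int[P]_w (Z w * G w)%:E = \int[P]_w (Z w * Gp w)%:E - \int[P]_w (Z w * Gm w)%:E)%E.
  move=> iZ iZG; rewrite -integralB//; [|exact: iH|exact: iH].
  by apply: eq_integral => w _; rewrite -EFinB -mulrBr -GE.
rewrite !E//; congr (_ - _)%E; apply: cond_exp_integral_mul_ge0 => //; exact: iH.
Qed.

End CondExp.

(** * Moments *)

Section Moments.
Context {dT : measure_display} {T : measurableType dT} {R : realType}.
Variables (P : probability T R) (q : R).
Hypothesis q0 : 0 < q.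
Local Notation p := (q + 2).

Definition inLp (X : T -> R) :=
  measurable_fun setT X /\ P.-integrable setT (fun w => (`|X w| `^ p)%:E).

Definition moment (X : T -> R) : R := \int[P]_w (`|X w| `^ p).

Let p0 : 0 < p. Proof. by rewrite addr_gt0. Qed.

Lemma moment_ge0 X : 0 <= moment X.
Proof. by apply: Rintegral_ge0 => w _; exact: powR_ge0. Qed.

Lemma measurable_abs_powR (r : R) (X : T -> R) : measurable_fun setT X ->
  measurable_fun setT (fun w => `|X w| `^ r).
Proof.
move=> mX; apply: (measurableT_comp (measurable_powR r)).
exact: measurableT_comp.
Qed.

Lemma EFin_Rintegral (f : T -> R) : P.-integrable setT (EFin \o f) ->
  (\int[P]_w (f w))%:E = (\int[P]_w (f w)%:E)%E.
Proof. by move=> fi; rewrite fineK//; exact: integrable_fin_num. Qed.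

Lemma dominated_integrable (f g : T -> R) : measurable_fun setT f ->
  (forall w, `|f w| <= g w) -> P.-integrable setT (EFin \o g) ->
  P.-integrable setT (EFin \o f).
Proof.
move=> mf fg; apply: le_integrable => //; first exact/measurable_EFinP.
by move=> w _; rewrite lee_fin (le_trans (fg w))// ler_norm.
Qed.

Lemma inLp0 : inLp (fun=> 0).
Proof.
split; first exact: measurable_cst.
under eq_fun do rewrite normr0 powR0 ?gt_eqF//.
exact: integrable0.
Qed.

Lemma inLpZ (c : R) X : inLp X -> inLp (fun w => c * X w).
Proof.
move=> [mX iX]; split; first exact: measurable_funM.
under eq_fun do rewrite normrM powRM// EFinM.
exact: integrableZl.
Qed.

Lemma momentZ (c : R) X : inLp X -> moment (fun w => c * X w) = `|c| `^ p * moment X.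
Proof.
move=> [mX iX]; rewrite /moment -RintegralZl//.
by apply: eq_Rintegral => w _; rewrite normrM powRM.
Qed.

Lemma inLpD X Y : inLp X -> inLp Y -> inLp (fun w => X w + Y w).
Proof.
move=> [mX iX] [mY iY]; split; first exact: measurable_funD.
apply: (@dominated_integrable _ (fun w => 2 `^ p * (`|X w| `^ p + `|Y w| `^ p))).
- by apply: measurable_abs_powR; exact: measurable_funD.
- move=> w; rewrite ger0_norm ?powR_ge0//.
  apply: (le_trans _ (powRD_le p0 (normr_ge0 (X w)) (normr_ge0 (Y w)))).
  by apply: le_powR; [exact: ltW| |exact: ler_normD].
- have -> : EFin \o (fun w => 2 `^ p * (`|X w| `^ p + `|Y w| `^ p)) =
     (fun w => (2 `^ p)%:E * ((`|X w| `^ p)%:E + (`|Y w| `^ p)%:E))%E.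
    by apply/funext => w; rewrite /= EFinM EFinD.
  by apply: integrableZl => //; exact: integrableD.
Qed.

Lemma inLp_sum (I : finType) (A : {set I}) (X : I -> T -> R) :
  (forall i, inLp (X i)) -> inLp (fun w => \sum_(i in A) X i w).
Proof.
move=> iX; have -> : (fun w => \sum_(i in A) X i w) = \sum_(i in A) X i.
  by apply/funext => w; rewrite fct_sumE.
apply: (big_ind inLp) => //; first exact: inLp0.
by move=> f g; exact: inLpD.
Qed.

Lemma measurable_spow (f : T -> R) : measurable_fun setT f ->
  measurable_fun setT (fun w => spow q (f w)).
Proof. by move=> mf; apply: measurable_funM => //; exact: measurable_abs_powR. Qed.

(** Pointwise, [|X| |S|^(q + 1)] is at most the larger of [|X|^p] and [|S|^p]. *)
Lemma integrable_mul_spow X S : inLp X -> inLp S ->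
  P.-integrable setT (EFin \o (fun w => X w * spow q (S w))).
Proof.
move=> [mX iX] [mS iS].
apply: (@dominated_integrable _ (fun w => `|X w| `^ p + `|S w| `^ p)).
- by apply: measurable_funM => //; exact: measurable_spow.
- move=> w; rewrite normrM norm_spow//.
  have mE (z : R) : 0 <= z -> z * z `^ (q + 1) = z `^ p.
    by move=> z0; rewrite (_ : q + 1 = p - 1) ?mulr_powRB1//; ring.
  have [XS|/ltW SX] := leP `|X w| `|S w|.
    by rewrite -(mE `|S w|)// ler_wpDl ?powR_ge0// ler_wpM2r// powR_ge0.
  rewrite -(mE `|X w|)// ler_wpDr ?powR_ge0// ler_wpM2l//.
  by apply: le_powR => //; rewrite addr_ge0// ltW.
- have := integrableD measurableT iX iS.
  by apply: eq_integrable => // w _; rewrite /= EFinD.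
Qed.

(** Hoelder's inequality with exponents [p / 2] and [p / q], conjugate because [p = q + 2]. *)
Lemma hoelder_moment (U S : T -> R) (N : R) : measurable_fun setT U ->
  (Lnorm P (p / 2)%:E (EFin \o U) <= N%:E)%E -> inLp S ->
  P.-integrable setT (EFin \o (fun w => `|U w| * `|S w| `^ q)) /\
  \int[P]_w (`|U w| * `|S w| `^ q) <= N * moment S `^ (q / p).
Proof.
move=> mU NU [mS iS].
have mSq : measurable_fun setT (fun w => `|S w| `^ q) by exact: measurable_abs_powR.
have pn : p != 0 by rewrite gt_eqF.
have qn : q != 0 by rewrite gt_eqF.
have := @hoelder _ T R P U (fun w => `|S w| `^ q) (p / 2) (p / q) mU mSq.
rewrite !divr_gt0// => /(_ isT isT).
have -> : (p / 2)^-1 + (p / q)^-1 = 1 by field; rewrite pn qn.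
move=> /(_ erefl).
have ES : (Lnorm P (p / q)%:E (EFin \o (fun w => `|S w| `^ q)%R) = (moment S `^ (q / p))%:E)%E.
  have E w : (`|(EFin \o (fun w => `|S w| `^ q)%R) w| `^ (p / q))%E = (`|S w| `^ p)%:E.
    rewrite /= (ger0_norm (powR_ge0 _ _)) -powRrM; congr (_ `^ _)%:E.
    by field.
  rewrite unlock; under eq_integral do rewrite E.
  by rewrite -EFin_Rintegral// poweR_EFin invf_div.
rewrite ES Lnorm1 => H.
have {}H : (\int[P]_w (`|U w| * `|S w| `^ q)%R%:E <= (N * moment S `^ (q / p))%:E)%E.
  rewrite EFinM; apply: le_trans (lee_wpmul2r _ NU); last by rewrite lee_fin powR_ge0.
  apply: le_trans H; rewrite le_eqVlt; apply/orP; left; apply/eqP.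
  by apply: eq_integral => w _; rewrite /= normrM (ger0_norm (powR_ge0 _ _)).
have iU : P.-integrable setT (EFin \o (fun w => `|U w| * `|S w| `^ q)).
  apply/integrableP; split.
    by apply/measurable_EFinP/measurable_funM => //; exact: measurableT_comp.
  apply: (@le_lt_trans _ _ (N * moment S `^ (q / p))%:E); last exact: ltry.
  apply: le_trans H; rewrite le_eqVlt; apply/orP; left; apply/eqP.
  by apply: eq_integral => w _; rewrite /= ger0_norm// mulr_ge0// powR_ge0.
by split=> //; rewrite -lee_fin EFin_Rintegral.
Qed.

Lemma Lnorm_sqr X : inLp X ->
  Lnorm P (p / 2)%:E (EFin \o (fun w => X w ^+ 2)) = (moment X `^ (2 / p))%:E.
Proof.
move=> [mX iX].
have E w : (`|(EFin \o (fun w => X w ^+ 2)%R) w| `^ (p / 2))%E = (`|X w| `^ p)%:E.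
  rewrite /= normrX -powR_mulrn// -powRrM; congr (_ `^ _)%:E.
  by field.
rewrite unlock; under eq_integral do rewrite E.
by rewrite -EFin_Rintegral// poweR_EFin invf_div.
Qed.

(** Integrated form of [powR_norm_taylor]; the term [X^2 |S|^q] is handled by [hoelder_moment] with
    [U = X^2], whose [L^(p/2)] norm is [moment X ^ (2 / p)]. *)
Lemma moment_taylor S X : inLp S -> inLp X ->
  moment (fun w => S w + X w) <= moment S + p * \int[P]_w (X w * spow q (S w))
   + p * (p - 1) * (1 + 2 `^ q) * (moment X `^ (2 / p) * moment S `^ (q / p) + moment X).
Proof.
move=> iS iX; have iSX := inLpD iS iX.
have [mX iX'] := iX; have [mS iS'] := iS; have [_ iSX'] := iSX.
have [iH leH] := hoelder_moment (measurable_funX 2 mX)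
  (eq_ind_r (fun x => (x <= _)%E) (lexx _) (Lnorm_sqr iX)) iS.
have iM := integrable_mul_spow iX iS.
set C := p * (p - 1) * (1 + 2 `^ q).
have C0 : 0 <= C.
  have p10 : 0 <= p - 1 by rewrite -addrA addr_ge0 ?ltW// subr_ge0 (ler_nat _ 1 2).
  have c0 : 0 <= 1 + 2 `^ q by rewrite addr_ge0 ?powR_ge0.
  by rewrite /C mulr_ge0// mulr_ge0// ltW.
pose F w := `|S w| `^ p + p * (X w * spow q (S w)) +
  C * (`|X w ^+ 2| * `|S w| `^ q + `|X w| `^ p).
have iF2 : P.-integrable setT (EFin \o (fun w => p * (X w * spow q (S w)))).
  have := integrableZl measurableT p iM.
  by apply: eq_integrable => // w _; rewrite /= EFinM.
have iF12 : P.-integrable setT (EFin \o (fun w => `|S w| `^ p + p * (X w * spow q (S w)))).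
  have := integrableD measurableT iS' iF2.
  by apply: eq_integrable => // w _; rewrite /= EFinD.
have iF3 : P.-integrable setT (EFin \o (fun w => `|X w ^+ 2| * `|S w| `^ q + `|X w| `^ p)).
  have := integrableD measurableT iH iX'.
  by apply: eq_integrable => // w _; rewrite /= EFinD.
have iF3' : P.-integrable setT (EFin \o (fun w => C * (`|X w ^+ 2| * `|S w| `^ q + `|X w| `^ p))).
  have := integrableZl measurableT C iF3.
  by apply: eq_integrable => // w _; rewrite /= EFinM.
have iF : P.-integrable setT (EFin \o F).
  have := integrableD measurableT iF12 iF3'.
  by apply: eq_integrable => // w _; rewrite /= EFinD.
apply: (@le_trans _ _ (\int[P]_w F w)).
  apply: le_Rintegral => // w _; rewrite /F.
  have := @powR_norm_taylor R p (S w) (X w).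
  rewrite addrK ltrDr => /(_ q0) /le_trans; apply.
  by rewrite (mulrC (spow _ _)) (mulrC (`|S w| `^ q)) (ger0_norm (sqr_ge0 _)).
rewrite /F RintegralD// RintegralD// !RintegralZl// RintegralD//.
by rewrite lerD2l ler_wpM2l// lerD2r.
Qed.

End Moments.

(** * Decoupling along the lexicographic order *)

Lemma lexlt_trans d (x y z : 'rV[int]_d) : lexlt x y -> lexlt y z -> lexlt x z.
Proof.
move=> [r [xyr xyq]] [s [yzs yzq]].
have [rs|sr|/val_inj rs] := ltngtP (val r) (val s).
- exists r; split; first by rewrite -(yzq r rs).
  by move=> t tr; rewrite xyq// yzq// (ltn_trans tr).
- exists s; split; first by rewrite xyq.
  by move=> t ts; rewrite xyq ?yzq// (ltn_trans ts).
- subst s; exists r; split; first exact: lt_trans yzs.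
  by move=> t tr; rewrite xyq// yzq.
Qed.

Lemma lexlt_total d (x y : 'rV[int]_d) : x != y -> lexlt x y \/ lexlt y x.
Proof.
move=> xy.
have [r0 r0P] : exists r, x ord0 r != y ord0 r.
  apply/existsP; apply: contraNT xy; rewrite negb_exists => /forallP H.
  by apply/eqP/rowP => r; have := H r; rewrite negbK => /eqP.
case: (@arg_minnP _ r0 (fun r => x ord0 r != y ord0 r) (@nat_of_ord d) r0P) => r rP rmin.
have eqs (q : 'I_d) : (q < r)%N -> x ord0 q = y ord0 q.
  by move=> qr; apply/eqP; apply: contraTT qr => /rmin; rewrite leqNgt.
move: rP; rewrite neq_lt => /orP[lt|lt]; [left|right]; exists r; split=> //.
by move=> q /eqs.
Qed.

Lemma lexlt_irr d (x : 'rV[int]_d) : ~ lexlt x x.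
Proof. by move=> [r []]; rewrite ltxx. Qed.

Lemma exists_lexmax d (I : finType) (s : I -> 'rV[int]_d) (A : {set I}) :
  injective s -> A != finset.set0 ->
  exists2 i, i \in A & forall j, j \in A -> j != i -> lexlt (s j) (s i).
Proof.
move=> sI; have [n] := ubnP #|A|; elim: n A => // n IH A An.
case/set0Pn => x xA; have [/eqP A0|A0] := boolP (A :\ x == finset.set0).
  exists x => // j jA jx; have : j \in A :\ x by rewrite !inE jx.
  by rewrite A0 inE.
have [|i] := IH (A :\ x) _ A0.
  by rewrite (cardsD1 x A) xA in An.
rewrite !inE => /andP[ix iA] imax.
have : s x != s i by rewrite (inj_eq sI) eq_sym.
move=> /lexlt_total[xi|ix'].
  exists i => // j jA ji; have [->//|jx] := eqVneq j x.
  by apply: imax => //; rewrite !inE jx.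
exists x => // j jA jx; have [->//|ji] := eqVneq j i.
by apply: lexlt_trans ix'; apply: imax => //; rewrite !inE jx.
Qed.

Lemma zabsN d (k : 'rV[int]_d) : zabs (- k) = zabs k.
Proof. by rewrite /zabs; apply: eq_bigr => l _; rewrite mxE abszN. Qed.

Lemma zabs_gt0 d (k : 'rV[int]_d) : k != 0 -> (0 < zabs k)%N.
Proof.
move=> k0; rewrite lt0n; apply: contra k0 => /eqP/eqP.
rewrite -leqn0 => /bigmax_leqP H; apply/eqP/rowP => l.
by have := H l isT; rewrite leqn0 absz_eq0 mxE => /eqP.
Qed.

(** Translation by [-y] preserves the order and the distances; it carries earlier sites into the
    index sets [V_0^m] of the conditional expectations. *)
Lemma Vset_sub d (x y : 'rV[int]_d) m : lexlt x y -> (m <= zabs (x - y))%N ->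
  Vset 0 m (x - y).
Proof.
move=> [r [xyr xyq]] mxy; split; last by rewrite sub0r zabsN.
exists r; split; first by rewrite !mxE subr_lt0.
by move=> t tr; rewrite !mxE xyq// subrr.
Qed.

Lemma lexlt_zabs_gt0 d (x y : 'rV[int]_d) : lexlt x y -> (0 < zabs (x - y))%N.
Proof.
move=> xy; apply: zabs_gt0; rewrite subr_eq0; apply/eqP => E.
by move: xy; rewrite E => /lexlt_irr.
Qed.

Section MomentInequality.
Context {d : nat} {dT : measure_display} {T : measurableType dT} {R : realType}.
Variables (P : probability T R) (eps : 'rV[int]_d -> T -> R) (q : R).
Hypothesis q0 : 0 < q.
Local Notation p := (q + 2).
Hypothesis meps : forall i, measurable_fun setT (eps i).
Hypothesis stat : strictly_stationary P eps.
Hypothesis eps0Lp : inLp P q (eps 0).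
Variable Y : nat -> T -> R.
Hypothesis condE : forall m, (1 <= m)%N ->
  is_cond_exp P (gen_sigma eps (Vset 0 m)) (eps 0) (Y m).

Definition cnorm (k : 'rV[int]_d) : \bar R :=
  Lnorm P (p / 2)%:E (fun w => (eps k w * Y (zabs k) w)%:E).
Hypothesis sumc : (esum (Vset 0%R 1) cnorm < +oo)%E.

(** The summand of (C3) as a real number. [fine] would send an infinite value to 0, but summability
    makes [cnorm] finite on [V_0^1], as [cnormE] records. *)
Definition ccoef k : R := fine (cnorm k).
Definition csum : R := fine (esum (Vset 0 1) cnorm).

Lemma cnorm_ge0 k : (0 <= cnorm k)%E. Proof. exact: Lnorm_ge0. Qed.

Lemma ccoef_ge0 k : 0 <= ccoef k. Proof. exact/fine_ge0/cnorm_ge0. Qed.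

Lemma esum_cnorm_fin : esum (Vset 0 1) cnorm \is a fin_num.
Proof. by rewrite ge0_fin_numE//; apply: esum_ge0 => k _; exact: cnorm_ge0. Qed.

Lemma csum_seq_le (s : seq 'rV[int]_d) : uniq s ->
  (forall k, k \in s -> Vset 0 1 k) -> (\sum_(k <- s) cnorm k <= csum%:E)%E.
Proof.
move=> us sV; rewrite fineK ?esum_cnorm_fin//; apply: esum_ge.
exists [set` s]; last by rewrite fsbig_seq.
by split=> //; exact: finite_seq.
Qed.

Lemma cnormE k : Vset 0 1 k -> cnorm k = (ccoef k)%:E.
Proof.
move=> Vk; rewrite fineK// ge0_fin_numE ?cnorm_ge0//.
have := @csum_seq_le [:: k] isT; rewrite big_seq1 => H.
by apply: le_lt_trans (H _) (ltry _) => j; rewrite inE => /eqP ->.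
Qed.

Lemma csum_le (I : finType) (f : I -> 'rV[int]_d) (A : {set I}) : injective f ->
  (forall i, i \in A -> Vset 0 1 (f i)) -> \sum_(i in A) ccoef (f i) <= csum.
Proof.
move=> fI AV.
have uf : uniq (map f (enum A)) by rewrite map_inj_uniq// enum_uniq.
have := csum_seq_le uf; rewrite big_map big_enum/=.
rewrite (eq_bigr (fun i => (ccoef (f i))%:E)); last by move=> i iA; rewrite cnormE//; exact: AV.
rewrite sumEFin lee_fin; apply => _ /mapP[i iA ->].
by apply: AV; move: iA; rewrite mem_enum.
Qed.

Lemma csum_ge0 : 0 <= csum.
Proof. by apply/fine_ge0/esum_ge0 => k _; exact: cnorm_ge0. Qed.

Lemma eps_inLp k : inLp P q (eps k).
Proof.
split=> //; have [_ /integrableP[m0 i0]] := eps0Lp.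
apply/integrableP; split; first exact/measurable_EFinP/measurable_abs_powR.
pose F (f : paths 'rV[int]_d R) := `|(`|f 0| `^ p)%:E|%E.
have mF : measurable_fun setT F.
  apply: measurableT_comp => //; apply/measurable_EFinP/measurable_abs_powR.
  exact: measurable_coord.
have := stationary_integral meps stat k mF.
rewrite /F /shifted; under eq_integral do rewrite add0r.
by under [in X in _ = X -> _]eq_integral do rewrite add0r; move=> ->.
Qed.

Section Sums.
Context {I : finType}.
Implicit Types (s : I -> 'rV[int]_d) (a : I -> R) (A : {set I}).

Definition site_sum s a A (w : T) : R := \sum_(j in A) a j * eps (s j) w.

Lemma site_sum_inLp s a A : inLp P q (site_sum s a A).
Proof. by apply: inLp_sum => // i; apply: inLpZ => //; exact: eps_inLp. Qed.

Lemma site_sum_setD1 s a A k w : k \in A ->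
  site_sum s a A w = a k * eps (s k) w + site_sum s a (A :\ k) w.
Proof. by move=> kA; rewrite /site_sum (big_setD1 k). Qed.

(** [site_sum] as a functional of the path, the form to which [stationary_integral] applies. *)
Definition coord_sum s a A (f : paths 'rV[int]_d R) : R := \sum_(j in A) a j * f (s j).

Lemma measurable_coord_sum s a A : measurable_fun setT (coord_sum s a A).
Proof.
rewrite /coord_sum; under eq_fun do rewrite big_mkcond.
apply: measurable_sum => i; case: (i \in A) => //.
by apply: measurable_funM => //; exact: measurable_coord.
Qed.

Lemma coord_sum_shifted s a A k w :
  coord_sum s a A (shifted eps k w) = site_sum (fun j => s j + k) a A w.
Proof. by []. Qed.

Lemma coord_sum_shifted0 s a A w :
  coord_sum s a A (shifted eps 0 w) = site_sum s a A w.
Proof. by apply: eq_bigr => j _; rewrite /shifted addr0. Qed.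

Lemma moment_shift s a A k :
  moment P q (site_sum (fun j => s j + k) a A) = moment P q (site_sum s a A).
Proof.
pose F f : \bar R := (`|coord_sum s a A f| `^ p)%:E.
have mF : measurable_fun setT F.
  apply/measurable_EFinP; apply: measurable_abs_powR.
  exact: measurable_coord_sum.
have := stationary_integral meps stat k mF.
rewrite /F; under [in X in _ = X -> _]eq_integral do rewrite coord_sum_shifted0.
by rewrite /moment /Rintegral => <-.
Qed.

(* Stationarity moves the site s i to the origin, the only site for which (C3)
   provides conditional expectations. *)
Lemma decouple s a A i k b : k \in A ->
  (forall j, j \in A -> lexlt (s j) (s i)) ->
  (forall j, j \in A -> (zabs (s k - s i) <= zabs (s j - s i))%N) ->
  moment P q (site_sum s a A) <= b -> moment P q (site_sum s a (A :\ k)) <= b ->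
  `|\int[P]_w (eps (s i) w * (spow q (site_sum s a A w) - spow q (site_sum s a (A :\ k) w)))|
   <= 2 * (q + 1) * (`|a k| * ccoef (s k - s i)) * b `^ (q / p).
Proof.
move=> kA ltA minA bA bAk.
pose t j := s j - s i; pose m := zabs (t k).
(* As [k] is a site of [A] nearest to [i], all translated sites [t j] lie in [V_0^m]. The increment
   [G] is therefore measurable for the sigma-algebra that defines [Y m]. *)
have m1 : (1 <= m)%N by apply: lexlt_zabs_gt0; exact: ltA.
pose G w := spow q (site_sum t a A w) - spow q (site_sum t a (A :\ k) w).
have p0 : 0 < p by rewrite addr_gt0.
have -> : \int[P]_w (eps (s i) w * (spow q (site_sum s a A w)
     - spow q (site_sum s a (A :\ k) w))) = \int[P]_w (eps 0 w * G w).
  pose F (f : paths 'rV[int]_d R) : \bar R :=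
    (f (s i) * (spow q (coord_sum s a A f) - spow q (coord_sum s a (A :\ k) f)))%:E.
  have mF : measurable_fun setT F.
    apply/measurable_EFinP/measurable_funM; first exact: measurable_coord.
    by apply: measurable_funB; apply: measurable_spow; exact: measurable_coord_sum.
  have := stationary_integral meps stat (- s i) mF; rewrite /F => H.
  rewrite /Rintegral; apply: (congr1 fine).
  under eq_integral do rewrite -!coord_sum_shifted0.
  under [RHS]eq_integral do rewrite /G -!coord_sum_shifted -(subrr (s i)).
  rewrite -[RHS]/(\int[P]_w F (shifted eps (- s i) w))%E H.
  by apply: eq_integral => w _; rewrite /shifted addr0.
pose Gs : set (set T) := [set B | exists j, Vset 0 m j /\ exists C : set R, measurable C /\
   B = eps j @^-1` C].
have mGs : Gs `<=` measurable.
  by move=> _ [j [_ [C [mC ->]]]]; rewrite -[X in measurable X]setTI; exact: meps.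
have ce := condE m1; have [mY iY _] := ce.
have mTG j : j \in A -> measurable_fun [set: g_sigma_algebraType Gs]
    (eps (t j) : g_sigma_algebraType Gs -> R).
  move=> jA _ C mC; rewrite setTI; apply: sub_sigma_algebra.
  exists (t j); split; first by apply: Vset_sub; [exact: ltA|exact: minA].
  by exists C.
have mSG (B : {set I}) : B \subset A -> measurable_fun [set: g_sigma_algebraType Gs]
    (site_sum t a B : g_sigma_algebraType Gs -> R).
  move=> BA; rewrite (_ : site_sum t a B =
      fun w => \sum_j (if j \in B then a j * eps (t j) w else 0)); last first.
    by apply/funext => w; rewrite /site_sum big_mkcond.
  apply: measurable_sum => j; case: (boolP (j \in B)) => // jB.
  have jA : j \in A by move/fintype.subsetP : BA; apply.
  by apply: measurable_funM => //; exact: mTG.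
have mG : measurable_fun [set: g_sigma_algebraType Gs] (G : g_sigma_algebraType Gs -> R).
  by apply: measurable_funB; apply: measurable_spow; apply: mSG => //; exact: subsetDl.
have mGT : measurable_fun setT G by exact: (sub_measurable_fun mGs).
have ieps0 : P.-integrable setT (EFin \o eps 0).
  apply: (@dominated_integrable _ _ _ P _ (fun w => 1 + `|eps 0 w| `^ p)) => //.
    move=> w; have [le1|/ltW ge1] := leP `|eps 0 w| 1.
      by rewrite ler_wpDr// powR_ge0.
    have p1 : 1 <= p by rewrite (@le_trans _ _ 2) ?ler1n// lerDr ltW.
    by rewrite ler_wpDl// le1r_powR.
  have := integrableD measurableT (finite_measure_integrable_cst P 1 measurableT) (eps0Lp.2).
  by apply: eq_integrable => // w _; rewrite /= EFinD.
have iepsG : P.-integrable setT (fun w => (eps 0 w * G w)%:E).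
  have iS B := integrable_mul_spow q0 (eps_inLp 0) (site_sum_inLp t a B).
  have := integrableB measurableT (iS A) (iS (A :\ k)).
  by apply: eq_integrable => // w _; rewrite /= /G mulrBr EFinB.
have mYm : measurable_fun setT (Y m).
  by apply/measurable_EFinP; exact: measurable_int iY.
pose U w := eps (t k) w * Y m w.
have mU : measurable_fun setT U by exact: measurable_funM.
have NU : (Lnorm P (p / 2)%:E (EFin \o U) <= (ccoef (t k))%:E)%E.
  by rewrite -cnormE//; apply: Vset_sub => //; exact: ltA.
have hB B : moment P q (site_sum t a B) <= b ->
   P.-integrable setT (EFin \o (fun w => `|U w| * `|site_sum t a B w| `^ q)) /\
   \int[P]_w (`|U w| * `|site_sum t a B w| `^ q) <= ccoef (t k) * b `^ (q / p).
  move=> mb; have [iH leH] := hoelder_moment q0 mU NU (site_sum_inLp t a B).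
  split=> //; apply: le_trans leH _; rewrite ler_wpM2l ?ccoef_ge0//.
  by apply: le_powR => //; [rewrite divr_ge0 ?ltW|exact: moment_ge0].
have [iA leA] : P.-integrable setT (EFin \o (fun w => `|U w| * `|site_sum t a A w| `^ q)) /\
   \int[P]_w (`|U w| * `|site_sum t a A w| `^ q) <= ccoef (t k) * b `^ (q / p).
  by apply: hB; rewrite moment_shift.
have [iAk leAk] : P.-integrable setT (EFin \o (fun w => `|U w| * `|site_sum t a (A :\ k) w| `^ q)) /\
   \int[P]_w (`|U w| * `|site_sum t a (A :\ k) w| `^ q) <= ccoef (t k) * b `^ (q / p).
  by apply: hB; rewrite moment_shift.
pose H w := (q + 1) * `|a k| * (`|U w| * `|site_sum t a A w| `^ q +
   `|U w| * `|site_sum t a (A :\ k) w| `^ q).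
have iH0 : P.-integrable setT (EFin \o (fun w => `|U w| * `|site_sum t a A w| `^ q +
   `|U w| * `|site_sum t a (A :\ k) w| `^ q)).
  have := integrableD measurableT iA iAk.
  by apply: eq_integrable => // w _; rewrite /= EFinD.
have iH : P.-integrable setT (EFin \o H).
  have := integrableZl measurableT ((q + 1) * `|a k|) iH0.
  by apply: eq_integrable => // w _; rewrite /= EFinM.
(* The two sums differ by [a k * eps (t k)], so the Lipschitz bound brings out the product
   [eps (t k) * Y m] controlled by (C3). One term for each of the two sums gives the factor 2 of the
   conclusion. *)
have YGH w : `|Y m w * G w| <= H w.
  rewrite normrM /G.
  have := @spow_lipschitz R q (site_sum t a A w) (site_sum t a (A :\ k) w) q0.
  rewrite {2}(site_sum_setD1 _ _ _ kA) addrK normrM => L.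
  apply: le_trans (ler_wpM2l (normr_ge0 _) L) _.
  rewrite /H /U normrM le_eqVlt; apply/orP; left; apply/eqP; ring.
have iYG : P.-integrable setT (EFin \o (fun w => Y m w * G w)).
  by apply: dominated_integrable iH => //; exact: measurable_funM.
rewrite /Rintegral (cond_exp_integral_mul mGs ce ieps0 mG iepsG iYG).
apply: le_trans (le_normr_Rintegral measurableT iYG) _.
apply: (@le_trans _ _ (\int[P]_w H w)).
  apply: le_Rintegral => //.
  by have := integrable_norm iYG; apply: eq_integrable.
have q10 : 0 <= q + 1 by rewrite addr_ge0// ltW.
rewrite /H RintegralZl// RintegralD//.
apply: le_trans (ler_wpM2l _ (lerD leA leAk)) _; first by rewrite mulr_ge0.
by rewrite le_eqVlt; apply/orP; left; apply/eqP; rewrite /t; ring.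
Qed.

End Sums.
End MomentInequality.

(** * Induction over the sites *)

Section MomentInduction.
Context {d : nat} {dT : measure_display} {T : measurableType dT} {R : realType}.
Variables (P : probability T R) (eps : 'rV[int]_d -> T -> R) (q : R).
Hypothesis q0 : 0 < q.
Local Notation p := (q + 2).
Hypothesis meps : forall i, measurable_fun setT (eps i).
Hypothesis stat : strictly_stationary P eps.
Hypothesis eps0Lp : inLp P q (eps 0).
Variable Y : nat -> T -> R.
Hypothesis condE : forall m, (1 <= m)%N ->
  is_cond_exp P (gen_sigma eps (Vset 0 m)) (eps 0) (Y m).
Hypothesis sumc : (esum (Vset 0%R 1) (cnorm P eps q Y) < +oo)%E.
Local Notation c := (ccoef P eps q Y).

Context {I : finType}.
Variables (s : I -> 'rV[int]_d) (a : I -> R).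
Hypothesis sI : injective s.

Let inLpS A : inLp P q (site_sum eps s a A).
Proof. exact: site_sum_inLp. Qed.

(* The sites of A are removed from the nearest to s i to the farthest. *)
Lemma mul_spow_site_sum_le (A : {set I}) i b :
  (forall j, j \in A -> lexlt (s j) (s i)) ->
  (forall B : {set I}, B \subset A -> moment P q (site_sum eps s a B) <= b) ->
  `|\int[P]_w (eps (s i) w * spow q (site_sum eps s a A w))|
   <= 2 * (q + 1) * (\sum_(k in A) `|a k| * c (s k - s i)) * b `^ (q / p).
Proof.
have [n] := ubnP #|A|; elim: n A => // n IH A An ltA mb.
have [->|/set0Pn[k0 k0A]] := eqVneq A finset.set0.
  rewrite big_set0 mulr0 mul0r /Rintegral integral0_eq ?normr0//.
  by move=> w _; rewrite /site_sum big_set0 /spow mul0r mulr0.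
case: (@arg_minnP _ k0 (fun k => k \in A) (fun k => zabs (s k - s i)) k0A) => k kA kmin.
have iS B : P.-integrable setT (EFin \o (fun w => eps (s i) w * spow q (site_sum eps s a B w))).
  by apply: integrable_mul_spow => //; exact: eps_inLp.
have iD : P.-integrable setT (EFin \o (fun w => eps (s i) w *
    (spow q (site_sum eps s a A w) - spow q (site_sum eps s a (A :\ k) w)))).
  have := integrableB measurableT (iS A) (iS (A :\ k)).
  by apply: eq_integrable => // w _; rewrite /= mulrBr EFinB.
have -> : \int[P]_w (eps (s i) w * spow q (site_sum eps s a A w)) =
   \int[P]_w (eps (s i) w * (spow q (site_sum eps s a A w) - spow q (site_sum eps s a (A :\ k) w)))
   + \int[P]_w (eps (s i) w * spow q (site_sum eps s a (A :\ k) w)).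
  by rewrite -RintegralD//; apply: eq_Rintegral => w _; rewrite -mulrDr subrK.
apply: le_trans (ler_normD _ _) _.
rewrite (big_setD1 k kA)/= mulrDr mulrDl lerD//.
  by apply: (decouple q0 meps stat eps0Lp condE sumc kA) => //; apply: mb => //; exact: subD1set.
apply: IH.
- by rewrite (cardsD1 k A) kA in An.
- by move=> j; rewrite !inE => /andP[_ jA]; exact: ltA.
- by move=> B BA; apply: mb; apply: fintype.subset_trans BA (subD1set _ _).
Qed.

(** The square of the [L^p] norm of [eps 0]. *)
Let s2 := moment P q (eps 0) `^ (2 / p).

(** The contribution of the site [i]: the squared [L^p] norm of [a i * eps (s i)], plus its coupling
    with the earlier sites as produced by [mul_spow_site_sum_le]. *)
Let interaction (A : {set I}) i :=
  s2 * a i ^+ 2 + `|a i| * \sum_(k in A | `[< lexlt (s k) (s i) >]) `|a k| * c (s k - s i).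

Let energy (A : {set I}) := \sum_(i in A) interaction A i.

Let s2_ge0 : 0 <= s2. Proof. exact: powR_ge0. Qed.

Let term_ge0 k i : 0 <= `|a k| * c (s k - s i).
Proof. by rewrite mulr_ge0// ccoef_ge0. Qed.

Let interaction_ge0 A i : 0 <= interaction A i.
Proof.
by rewrite addr_ge0// mulr_ge0 ?sqr_ge0// sumr_ge0.
Qed.

Let energy_ge0 A : 0 <= energy A.
Proof. exact: sumr_ge0. Qed.

Let le_sum_subset (A B : {set I}) (Q : pred I) (F : I -> R) : B \subset A ->
  (forall i, 0 <= F i) -> \sum_(i in B | Q i) F i <= \sum_(i in A | Q i) F i.
Proof.
move=> /fintype.subsetP BA F0; rewrite big_mkcond [leRHS]big_mkcond.
apply: ler_sum => i _; have [iB|iB] := boolP (i \in B); first by rewrite BA.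
by case: ifP.
Qed.

Let le_interaction (A B : {set I}) i : B \subset A -> interaction B i <= interaction A i.
Proof.
by move=> BA; rewrite lerD2l ler_wpM2l// le_sum_subset.
Qed.

Let le_energy (A B : {set I}) : B \subset A -> energy B <= energy A.
Proof.
move=> BA; apply: (@le_trans _ _ (\sum_(i in B) interaction A i)).
  by apply: ler_sum => i _; exact: le_interaction.
have := @le_sum_subset A B predT (interaction A) BA (interaction_ge0 A).
by under eq_bigl do rewrite andbT; under [X in _ <= X]eq_bigl do rewrite andbT.
Qed.

Let C1 := p * (p - 1) * (1 + 2 `^ q).
(** Large enough for [powR_step] at exponent [p / 2], with coefficients [p * (2 * (q + 1)) + C1] for
    the mixed term and [C1] for the pure power. *)
Let D := 2 * (p * (2 * (q + 1)) + C1) + 1.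

Let C1_ge0 : 0 <= C1.
Proof.
have ? := powR_ge0 (2 : R) q; have ? := q0.
by rewrite /C1 mulr_ge0 ?mulr_ge0//; lra.
Qed.

Let K_ge0 : 0 <= p * (2 * (q + 1)) + C1.
Proof.
by rewrite addr_ge0// mulr_ge0 ?mulr_ge0 ?addr_ge0// ltW.
Qed.

Let D_ge1 : 1 <= D.
Proof. by rewrite /D lerDr mulr_ge0. Qed.

Lemma moment_eps i : moment P q (eps i) = moment P q (eps 0).
Proof.
have := moment_shift q meps stat (fun _ : unit => 0) (fun _ => 1) [set tt]%SET i.
have E (t : unit -> 'rV[int]_d) : site_sum eps t (fun=> 1) [set tt]%SET = eps (t tt).
  by apply/funext => w; rewrite /site_sum big_set1 mul1r.
by rewrite !E add0r.
Qed.

(** Induction on the cardinality, removing the lexicographically largest site. In the Taylor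
    expansion around the remaining sum, both correction terms are controlled by the energy gained,
    and [powR_step] closes the recursion. *)
Let moment_site_sum_le (A : {set I}) :
  moment P q (site_sum eps s a A) <= (D * energy A) `^ (p / 2).
Proof.
have p0 : 0 < p by rewrite addr_gt0.
have D0 : 0 <= D by exact: le_trans ler01 D_ge1.
have [n] := ubnP #|A|; elim: n A => // n IH A An.
have [->|An0] := eqVneq A finset.set0.
  rewrite (_ : site_sum _ _ _ _ = fun=> 0); last first.
    by apply/funext => w; rewrite /site_sum big_set0.
  rewrite /moment /Rintegral integral0_eq ?powR_ge0// => w _.
  by rewrite normr0 powR0// gt_eqF.
have [i iA imax] := exists_lexmax sI An0.
set A' := A :\ i; set e := interaction A i.
have A'A : A' \subset A by exact: subD1set.
have ltA' j : j \in A' -> lexlt (s j) (s i).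
  by rewrite !inE => /andP[ji jA]; exact: imax.
(* Removing [i] loses at least its interaction [e], since the interactions of the other sites can
   only decrease. *)
have En : D * energy A' + D * e <= D * energy A.
  rewrite -mulrDr ler_wpM2l// [leRHS](big_setD1 i iA) addrC lerD2l.
  by apply: ler_sum => j _; exact: le_interaction.
have B0 : 0 <= D * energy A' by rewrite mulr_ge0.
have e0 : 0 <= e by exact: interaction_ge0.
apply: (@le_trans _ _ ((D * energy A' + D * e) `^ (p / 2))); last first.
  by apply: le_powR => //; [rewrite divr_ge0 ?ltW|rewrite addr_ge0// mulr_ge0].
(* The bound is required for every subset of [A'], because the first-order estimate peels the sites
   of [A'] off one by one. *)
have mb (B : {set I}) : B \subset A' -> moment P q (site_sum eps s a B) <= (D * energy A') `^ (p / 2).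
  move=> BA; apply: (@le_trans _ _ ((D * energy B) `^ (p / 2))).
    apply: IH; apply: leq_ltn_trans (subset_leq_card BA) _.
    by rewrite (cardsD1 i A) iA in An.
  apply: le_powR; [by rewrite divr_ge0 ?ltW|by rewrite mulr_ge0|].
  by rewrite ler_wpM2l// le_energy.
have iX : inLp P q (fun w => a i * eps (s i) w).
  by apply: inLpZ => //; exact: eps_inLp.
have -> : site_sum eps s a A = (fun w => site_sum eps s a A' w + a i * eps (s i) w).
  by apply/funext => w; rewrite (site_sum_setD1 _ _ _ _ iA) addrC.
apply: le_trans (moment_taylor q0 (inLpS A') iX) _.
have bE (r : R) : ((D * energy A') `^ (p / 2)) `^ (r / p) = (D * energy A') `^ (r / 2).
  by rewrite -powRrM; congr powR; field; rewrite gt_eqF.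
have M2 : moment P q (fun w => a i * eps (s i) w) `^ (2 / p) = s2 * a i ^+ 2.
  rewrite momentZ//; last exact: eps_inLp.
  rewrite moment_eps powRM ?powR_ge0 ?moment_ge0// mulrC -powRrM.
  rewrite (_ : p * (2 / p) = 2%:R); last by field; rewrite gt_eqF.
  by rewrite powR_mulrn// real_normK ?num_real.
have M1 : moment P q (fun w => a i * eps (s i) w) = (s2 * a i ^+ 2) `^ (p / 2).
  rewrite -M2 -powRrM (_ : 2 / p * (p / 2) = 1) ?powRr1 ?moment_ge0//.
  by field; rewrite gt_eqF.
pose L := \sum_(k in A') `|a k| * c (s k - s i).
(* As [i] is the lexicographic maximum of [A], its predecessors in [A] are exactly the sites of
   [A']. *)
have eE : e = s2 * a i ^+ 2 + `|a i| * L.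
  rewrite /e /interaction /L; congr (_ + _ * _); apply: eq_bigl => j.
  rewrite !inE; have [jA|jA] := boolP (j \in A); last by rewrite andbF.
  have [->|ji] := eqVneq j i => /=; first by apply/asboolP/lexlt_irr.
  by apply/asboolP; exact: imax.
have L0 : 0 <= L by apply: sumr_ge0.
have cross : \int[P]_w (a i * eps (s i) w * spow q (site_sum eps s a A' w)) <=
    `|a i| * (2 * (q + 1) * L * (D * energy A') `^ (q / 2)).
  have -> : \int[P]_w (a i * eps (s i) w * spow q (site_sum eps s a A' w)) =
      a i * \int[P]_w (eps (s i) w * spow q (site_sum eps s a A' w)).
    rewrite -RintegralZl//; last by apply: integrable_mul_spow => //; exact: eps_inLp.
    by apply: eq_Rintegral => w _; rewrite mulrA.
  apply: le_trans (ler_norm _) _; rewrite normrM ler_wpM2l// -bE.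
  exact: mul_spow_site_sum_le.
have q1 : 1 < p / 2 by have := q0; lra.
have pq : q / 2 = p / 2 - 1 by field.
have W0 := powR_ge0 (D * energy A') (p / 2 - 1).
have sa0 : 0 <= s2 * a i ^+ 2 by rewrite mulr_ge0// sqr_ge0.
have aL0 : 0 <= `|a i| * L by rewrite mulr_ge0.
set b := D * energy A' in B0 bE mb cross W0 *.
rewrite pq in cross.
have H1 := mb _ (subxx A').
have H2 : p * \int[P]_w (a i * eps (s i) w * spow q (site_sum eps s a A' w)) <=
    p * (2 * (q + 1)) * e * b `^ (p / 2 - 1).
  rewrite -!mulrA ler_wpM2l ?(ltW p0)//; apply: le_trans cross _.
  rewrite (_ : `|a i| * _ = 2 * (q + 1) * (`|a i| * L * b `^ (p / 2 - 1))); last by ring.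
  rewrite -mulrA !ler_wpM2l ?ler_wpM2r ?addr_ge0 ?(ltW q0)//.
  by rewrite eE lerDr.
have H3 : s2 * a i ^+ 2 * moment P q (site_sum eps s a A') `^ (q / p) + (s2 * a i ^+ 2) `^ (p / 2)
    <= e * b `^ (p / 2 - 1) + e `^ (p / 2).
  rewrite lerD//; last first.
    by apply: le_powR => //; [rewrite divr_ge0 ?ltW|rewrite eE lerDl].
  rewrite ler_pM ?powR_ge0//; first by rewrite eE lerDl.
  rewrite -pq -bE; apply: le_powR => //; first by rewrite divr_ge0 ?ltW.
  exact: moment_ge0.
have H4 := ler_wpM2l C1_ge0 H3.
have K1 : (p * (2 * (q + 1)) + C1) * 2 <= p / 2 * D.
  apply: (@le_trans _ _ D); first by rewrite /D mulrC lerDl.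
  by rewrite ler_peMl ?(le_trans ler01)// ltW.
have K2 : C1 * 2 <= D.
  by rewrite /D mulrC mulrDr -addrA ler_wpDl ?ler_wpDr// !mulr_ge0 ?addr_ge0// ltW.
have F := @powR_step R (p / 2) b e (p * (2 * (q + 1)) + C1) C1 D q1 B0 e0 K_ge0 C1_ge0 D_ge1 K1 K2.
apply: le_trans _ F; rewrite M2 M1 -/C1.
apply: le_trans (lerD (lerD H1 H2) H4) _.
by rewrite le_eqVlt; apply/orP; left; apply/eqP; ring.
Qed.

(** By [|a_i a_k| <= (a_i^2 + a_k^2) / 2], it suffices to sum the coefficients over [k] for fixed
    [i] and over [i] for fixed [k]. Injectivity of [s] makes the differences distinct, so (C3)
    bounds both sums. *)
Let energy_le (A : {set I}) :
  energy A <= (s2 + csum P eps q Y) * \sum_(i in A) a i ^+ 2.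
Proof.
pose M := csum P eps q Y.
have pairs : \sum_(i in A) `|a i| * (\sum_(k in A | `[< lexlt (s k) (s i) >]) `|a k| * c (s k - s i))
   <= \sum_(i in A) \sum_(k in A | `[< lexlt (s k) (s i) >])
        (2^-1 * a i ^+ 2 * c (s k - s i) + 2^-1 * a k ^+ 2 * c (s k - s i)).
  apply: ler_sum => i _; rewrite mulr_sumr; apply: ler_sum => k _.
  rewrite mulrA -mulrDl ler_wpM2r ?ccoef_ge0// -(real_normK (num_real (a i))).
  rewrite -(real_normK (num_real (a k))).
  have := sqr_ge0 (`|a i| - `|a k|); nra.
have V k i : lexlt (s k) (s i) -> Vset 0 1 (s k - s i).
  by move=> ki; apply: Vset_sub => //; exact: lexlt_zabs_gt0.
have row i : \sum_(k in A | `[< lexlt (s k) (s i) >]) c (s k - s i) <= M.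
  have := @csum_le _ _ _ _ P eps q Y sumc _ (fun k => s k - s i)
    [set k in A | `[< lexlt (s k) (s i) >]]%SET.
  rewrite (eq_bigl (fun k => (k \in A) && `[< lexlt (s k) (s i) >])); last first.
    by move=> k; rewrite inE.
  apply; first by move=> k l /addIr /sI.
  by move=> k; rewrite inE => /andP[_ /asboolP]; exact: V.
have col k : \sum_(i in A | `[< lexlt (s k) (s i) >]) c (s k - s i) <= M.
  have := @csum_le _ _ _ _ P eps q Y sumc _ (fun i => s k - s i)
    [set i in A | `[< lexlt (s k) (s i) >]]%SET.
  rewrite (eq_bigl (fun i => (i \in A) && `[< lexlt (s k) (s i) >])); last first.
    by move=> i; rewrite inE.
  apply; first by move=> i l /addrI /oppr_inj /sI.
  by move=> i; rewrite inE => /andP[_ /asboolP]; exact: V.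
rewrite /energy /interaction big_split/= -mulr_sumr mulrDl lerD2l.
apply: le_trans pairs _.
rewrite (eq_bigr (fun i => \sum_(k in A | `[< lexlt (s k) (s i) >]) 2^-1 * a i ^+ 2 * c (s k - s i) +
   \sum_(k in A | `[< lexlt (s k) (s i) >]) 2^-1 * a k ^+ 2 * c (s k - s i))); last first.
  by move=> i _; exact: big_split.
rewrite big_split/= (_ : csum _ _ _ _ * _ = M * (2^-1 * \sum_(i in A) a i ^+ 2) + M * (2^-1 * \sum_(i in A) a i ^+ 2)); last first.
  by rewrite /M; field.
rewrite lerD//.
  rewrite !mulr_sumr; apply: ler_sum => i _.
  by rewrite -mulr_sumr mulrC ler_wpM2r// mulr_ge0// sqr_ge0.
rewrite (exchange_big_dep (fun k => k \in A))/=; last by move=> i k _ /andP[].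
rewrite !mulr_sumr; apply: ler_sum => k kA.
rewrite -mulr_sumr mulrC ler_wpM2r//; first by rewrite mulr_ge0// sqr_ge0.
by apply: le_trans (col k); rewrite le_eqVlt; apply/orP; left; apply/eqP/eq_bigl => i; rewrite kA.
Qed.

Theorem moment_site_sum :
  moment P q (site_sum eps s a [set: I]%SET) <=
   (D * (s2 + csum P eps q Y) * \sum_i a i ^+ 2) `^ (p / 2).
Proof.
apply: le_trans (moment_site_sum_le _) _.
have p0 : 0 < p by rewrite addr_gt0.
have D0 : 0 <= D by exact: le_trans ler01 D_ge1.
apply: le_powR; [by rewrite divr_ge0 ?ltW|by rewrite mulr_ge0|].
rewrite -mulrA ler_wpM2l//; apply: le_trans (energy_le _) _.
by rewrite big_mkcond/=; under eq_bigr do rewrite inE.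
Qed.

End MomentInduction.

(** * Dyadic decomposition of windows *)

(* [0, t[ is the disjoint union of one dyadic interval for each binary digit 1 of t. *)
Lemma prefix_dyadic (R : comPzRingType) N t i : (t < 2 ^ N)%N ->
  ((i < t)%N%:R : R) =
  \sum_(j < N) (odd (t %/ 2 ^ j))%:R * (i %/ 2 ^ j == (t %/ 2 ^ j).-1)%N%:R.
Proof.
elim: N t i => [|N IH] t i tN.
  by rewrite expn0 ltnS leqn0 in tN; rewrite big_ord0 (eqP tN) ltn0.
(* The lowest digit is split off: if [t] is odd it accounts for [i = t - 1], and otherwise [i < t]
   is decided by the halves of [i] and [t]. *)
rewrite big_ord_recl expn0 !divn1.
under eq_bigr => j _ do rewrite /= /bump add1n expnS !divnMA.
rewrite -IH; last by rewrite ltn_divLR// mulnC -expnS.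
rewrite -natrM -natrD !divn2; congr (_%:R).
have := odd_double_half t; have := odd_double_half i.
case: (odd t); case: (odd i) => /= Hi Ht; rewrite -?mul2n in Hi Ht *; lia.
Qed.

(** The window [[u, v[] is [[b, v[] minus [[b, min(u, v)[]; the Boolean selects the endpoint and the
    sign, and the minimum takes care of empty windows. Prefixes start at [b], so the dyadic
    intervals depend on [b] and not on where [u] lies. *)
Lemma window_dyadic (R : comPzRingType) N b u v i : (b <= u)%N -> (v - b < 2 ^ N)%N ->
  let t (s : bool) := ((if s then v else minn u v) - b)%N in
  ((u <= i < v)%N%:R : R) = \sum_(js : 'I_N * bool)
    ((-1) ^+ (~~ js.2) * (odd (t js.2 %/ 2 ^ js.1))%:R) *
    ((b <= i) && ((i - b) %/ 2 ^ js.1 == (t js.2 %/ 2 ^ js.1).-1))%N%:R.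
Proof.
move=> bu vN t.
rewrite -(pair_bigA _ (fun (j : 'I_N) (s : bool) => ((-1) ^+ (~~ s) * (odd (t s %/ 2 ^ j))%:R) *
    ((b <= i) && ((i - b) %/ 2 ^ j == (t s %/ 2 ^ j).-1))%N%:R)) exchange_big/=.
have [bi|ib] := leqP b i; last first.
  rewrite big1 => [|s _]; last by rewrite big1 => [|j _]; rewrite ?mulr0.
  by rewrite leqNgt (leq_trans ib bu).
under eq_bigr => s _ do under eq_bigr => j _ do rewrite -mulrA.
under eq_bigr => s _ do rewrite -mulr_sumr.
have tN s : (t s < 2 ^ N)%N.
  by apply: leq_ltn_trans vN; rewrite /t leq_sub2r//; case: s => //; exact: geq_minr.
under eq_bigr => s _ do rewrite /= -(prefix_dyadic R (i - b) (tN s)).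
rewrite big_bool/= expr0 mul1r expr1 mulN1r /t.
have [vu|uv] := leqP v u.
  by rewrite subrr; case: (leqP u i) => //= ui; rewrite ltnNge (leq_trans vu ui).
have -> : (i - b < v - b)%N = (i < v)%N by lia.
have -> : (i - b < u - b)%N = (i < u)%N by lia.
case: (leqP u i) => ui /=; first by rewrite subr0.
by rewrite (ltn_trans ui uv) subrr.
Qed.

Lemma card_family_le (I : finType) d (F : 'I_d -> pred I) (c : 'I_d -> nat) :
  (forall l, #|F l| <= c l)%N ->
  (#|[set f : {ffun 'I_d -> I} | [forall l, F l (f l)]]%SET| <= \prod_l c l)%N.
Proof.
move=> Fc; rewrite (_ : #|_| = #|family F|).
  rewrite card_family foldrE big_image/=; exact: leq_prod.
by apply: eq_card => f; rewrite inE; apply/forallP/familyP.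
Qed.

(** The remainder modulo [2^j] is injective on the interval. The site of index [x] is [x.+1], as the
    grid is numbered from 1. *)
Lemma card_dyadic_le n b j k :
  (#|[pred x : 'I_n | (b <= x.+1) && ((x.+1 - b) %/ 2 ^ j == k)]| <= 2 ^ j)%N.
Proof.
set A := [pred x : 'I_n | _].
have j0 : (0 < 2 ^ j)%N by rewrite expn_gt0.
pose f (x : 'I_n) : 'I_(2 ^ j) := Ordinal (ltn_pmod (x.+1 - b) j0).
rewrite -[leqRHS]card_ord -(card_in_imset (f := f)); first exact: max_card.
move=> x y /andP[bx /eqP xk] /andP[by' /eqP yk] /(congr1 val)/= xy.
apply: val_inj; have := divn_eq (x.+1 - b) (2 ^ j); have := divn_eq (y.+1 - b) (2 ^ j).
rewrite xk yk xy => <- /eqP; rewrite -(eqn_add2r b) !subnK// => /eqP[].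
by [].
Qed.

(** * Dyadic boxes in dimension [d] *)

Section Blocks.
Context {d n N : nat} {R : realType}.
Local Notation index := {ffun 'I_d -> 'I_n}.
Local Notation level := {ffun 'I_d -> 'I_N * bool}.
Local Notation position := {ffun 'I_d -> 'I_(2 ^ N)}.
Implicit Types (b u v : 'I_d -> nat) (J : level) (k : position) (i : index).

(** In each coordinate, [(J l).1] is the dyadic exponent and [k l] the rank of the interval counted
    from [b l]; [(J l).2] records the endpoint of the window that it serves. *)
Definition in_block b J k i :=
  [forall l, (b l <= (i l).+1) && (((i l).+1 - b l) %/ 2 ^ (J l).1 == k l)]%N.

Definition block_sum b J k (w : index -> R) : R := \sum_i w i * (in_block b J k i)%:R.

(** A range of length [2^N] has [2^(N - j)] intervals of length [2^j]: the larger the blocks, the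
    fewer the positions. *)
Definition admissible J : {set position} :=
  [set k : position | [forall l, (k l < 2 ^ (N - (J l).1))%N]]%SET.

Lemma prodr_nat_of_bool (F : 'I_d -> bool) : \prod_l (F l)%:R = [forall l, F l]%:R :> R.
Proof.
have [/forallP H|] := boolP [forall l, F l]; first by rewrite big1// => l _; rewrite H.
rewrite negb_forall => /existsP[l /negbTE Fl].
by rewrite (bigD1 l)//= Fl mul0r.
Qed.

(** Expanding the product of the one-dimensional decompositions gives one block per level [J]. Its
    position varies with [u] and [v], but within the finite set [admissible J]; this discretizes the
    supremum. *)
Lemma window_sum_le b u v (w : index -> R) :
  (forall l, (b l <= u l)%N) -> (forall l, (v l - b l < 2 ^ N)%N) ->
  exists k : level -> position, (forall J, k J \in admissible J) /\
  `|\sum_i w i * [forall l, (u l <= (i l).+1 < v l)%N]%:R| <=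
    \sum_J `|block_sum b J (k J) w|.
Proof.
move=> bu vN.
pose t l (s : bool) := ((if s then v l else minn (u l) (v l)) - b l)%N.
have tN l s : (t l s < 2 ^ N)%N.
  by apply: leq_ltn_trans (vN l); rewrite /t leq_sub2r//; case: s => //; exact: geq_minr.
have kN l (js : 'I_N * bool) : ((t l js.2 %/ 2 ^ js.1).-1 < 2 ^ (N - js.1))%N.
  have : (t l js.2 %/ 2 ^ js.1 < 2 ^ (N - js.1))%N.
    by rewrite ltn_divLR ?expn_gt0// -expnD subnK// ltnW.
  by apply: leq_ltn_trans; rewrite leq_pred.
have kN' l (js : 'I_N * bool) : ((t l js.2 %/ 2 ^ js.1).-1 < 2 ^ N)%N.
  by apply: leq_trans (kN l js) _; rewrite leq_exp2l// leq_subr.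
exists (fun J => [ffun l => Ordinal (kN' l (J l))]); split.
  by move=> J; rewrite inE; apply/forallP => l; rewrite ffunE /=; exact: kN.
pose sg l (js : 'I_N * bool) : R := (-1) ^+ (~~ js.2) * (odd (t l js.2 %/ 2 ^ js.1))%:R.
pose B l (js : 'I_N * bool) (x : 'I_n) :=
  ((b l <= x.+1) && ((x.+1 - b l) %/ 2 ^ js.1 == (t l js.2 %/ 2 ^ js.1).-1))%N.
have E i : [forall l, (u l <= (i l).+1 < v l)%N]%:R =
    \sum_(J : level) (\prod_l sg l (J l)) * (\prod_l (B l (J l) (i l))%:R) :> R.
  rewrite -prodr_nat_of_bool.
  under eq_bigr => l _ do rewrite (window_dyadic R (i l).+1 (bu l) (vN l)).
  rewrite bigA_distr_bigA/=; apply: eq_bigr => J _.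
  by rewrite -big_split.
have -> : \sum_i w i * [forall l, (u l <= (i l).+1 < v l)%N]%:R =
    \sum_(J : level) (\prod_l sg l (J l)) * block_sum b J [ffun l => Ordinal (kN' l (J l))] w.
  under eq_bigr => i _ do rewrite E mulr_sumr.
  rewrite exchange_big; apply: eq_bigr => J _ /=.
  rewrite /block_sum mulr_sumr; apply: eq_bigr => i _.
  rewrite mulrCA; congr (_ * (_ * _)); rewrite prodr_nat_of_bool; congr (_%:R).
  by congr nat_of_bool; apply: eq_forallb => l; rewrite ffunE.
(* Every coefficient is a product of factors 0, 1 or -1. *)
apply: le_trans (ler_norm_sum _ _ _) _; apply: ler_sum => J _.
rewrite normrM ler_piMl// normr_prod; apply: prodr_ile1 => l _.
rewrite normr_ge0 /sg normrM normrX normrN1 expr1n mul1r.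
by case: (odd _); rewrite /= ?normr1 ?normr0 ?lexx ?ler01.
Qed.

Lemma sum_in_block_le b J k : \sum_i (in_block b J k i)%:R <= \prod_l (2 ^+ (J l).1) :> R.
Proof.
rewrite (_ : \sum_i _ = #|[set i | in_block b J k i]%SET|%:R); last first.
  rewrite -sum1dep_card natr_sum [RHS]big_mkcond.
  by apply: eq_bigr => i _; case: (in_block b J k i).
apply: (@le_trans _ _ (\prod_l (2 ^ (J l).1)%N)%:R).
  rewrite ler_nat; apply: (card_family_le (F := fun l => [pred x : 'I_n |
    ((b l <= x.+1) && ((x.+1 - b l) %/ 2 ^ (J l).1 == k l))%N])) => l.
  exact: card_dyadic_le.
by rewrite natr_prod le_eqVlt; apply/orP; left; apply/eqP/eq_bigr => l _; rewrite natrX.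
Qed.

Lemma card_admissible_le J : #|admissible J|%:R <= \prod_l (2 ^+ (N - (J l).1)) :> R.
Proof.
apply: (@le_trans _ _ (\prod_l (2 ^ (N - (J l).1))%N)%:R).
  rewrite ler_nat.
  apply: (card_family_le (F := fun l => [pred x : 'I_(2 ^ N) | (x < 2 ^ (N - (J l).1))%N])) => l.
  set m := (2 ^ (N - (J l).1))%N; rewrite -[leqRHS]card_ord.
  have m0 : (0 < m)%N by rewrite expn_gt0.
  pose f (x : 'I_(2 ^ N)) : 'I_m := Ordinal (ltn_pmod x m0).
  rewrite -(card_in_imset (f := f)); first exact: max_card.
  by move=> x y /= xm ym /(congr1 val)/=; rewrite !modn_small// => /val_inj.
by rewrite natr_prod le_eqVlt; apply/orP; left; apply/eqP/eq_bigr => l _; rewrite natrX.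
Qed.

End Blocks.

(** * Kernel weights *)

(** Nearest-point retraction of the line onto [[-1, 1]]. It is 1-Lipschitz, so composing [K] with it
    coordinatewise removes the jump at the boundary. *)
Definition clamp {R : realType} (t : R) : R := Num.max (-1) (Num.min 1 t).

Lemma clamp_itv {R : realType} (t : R) : -1 <= clamp t <= 1.
Proof.
rewrite /clamp le_max lexx/= ge_max; apply/andP; split; first by lra.
by rewrite ge_min lexx.
Qed.

Lemma clamp_id {R : realType} (t : R) : -1 <= t <= 1 -> clamp t = t.
Proof. by rewrite /clamp => /andP[t0 t1]; rewrite (min_idPr t1) (max_idPr t0). Qed.

Lemma clamp_cases {R : realType} (t : R) :
  [\/ t <= -1 /\ clamp t = -1, -1 <= t <= 1 /\ clamp t = t | 1 <= t /\ clamp t = 1].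
Proof.
rewrite /clamp; have [t1|/ltW t1] := leP t (-1).
  by apply: Or31; split=> //; apply/max_idPl; rewrite ge_min t1 orbT.
have [t2|/ltW t2] := leP t 1; first by apply: Or32; rewrite t1; split=> //; apply/max_idPr.
by apply: Or33; split=> //; apply/max_idPr; lra.
Qed.

Lemma clamp_lipschitz {R : realType} (s t : R) : `|clamp s - clamp t| <= `|s - t|.
Proof.
have A := ler_norm (s - t); have := ler_norm (t - s); rewrite distrC => B.
rewrite ler_norml; move: A B; move: (`|s - t|) => r A B.
case: (clamp_cases s) => -[s1 ->]; case: (clamp_cases t) => -[t1 ->];
  by apply/andP; split; lra.
Qed.

Definition clampv {R : realType} d (z : 'rV[R]_d) : 'rV[R]_d := \row_l clamp (z ord0 l).

Lemma cube11_clampv {R : realType} d (z : 'rV[R]_d) : cube11 (clampv z).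
Proof. by move=> l; rewrite mxE clamp_itv. Qed.

Lemma supnorm_le {R : realType} d (z : 'rV[R]_d) e : 0 <= e ->
  (forall l, `|z ord0 l| <= e) -> supnorm z <= e.
Proof. by move=> e0 ze; rewrite /supnorm; apply: bigmax_le. Qed.

(** The least natural number that is at least [z]: the first site of a window starting at [z]. *)
Definition lo {R : realType} (z : R) : nat :=
  absz (Num.max (0 : int) (Num.ceil z)).

Lemma lo_le {R : realType} (z : R) (k : nat) : (lo z <= k)%N = (z <= k%:R).
Proof.
rewrite -lez_nat /lo gez0_abs ?le_max ?lexx// ge_max le0z_nat.
by rewrite ceil_le_int.
Qed.

Lemma trunc_le_lo {R : realType} (y z : R) : y <= z -> (Num.trunc y <= lo z)%N.
Proof.
move=> yz; apply: leq_trans (le_truncn yz) _.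
have [z0|z0] := leP 0 z.
  rewrite -(ler_nat R); have /andP[/le_trans H _] := truncn_itv z0; apply: H.
  by rewrite -lo_le.
suff -> : Num.trunc z = 0%N by [].
by apply/eqP; rewrite -leqn0 truncn_le_nat (lt_trans z0).
Qed.

Lemma trunc_gt_sub1 {R : realType} (z : R) : z - 1 < (Num.trunc z)%:R.
Proof.
have [z0|z0] := leP 0 z; last by rewrite (@lt_le_trans _ _ 0)//; lra.
by have /andP[_] := truncn_itv z0; rewrite -natr1; lra.
Qed.

(** The summand 2 absorbs one unit for the successor and less than one for the truncation of [y]. *)
Lemma window_span {R : realType} (y z : R) N : 0 <= z -> z - y + 2 <= 2 ^+ N ->
  ((Num.trunc z).+1 - Num.trunc y < 2 ^ N)%N.
Proof.
move=> z0 zyN; have [le|lt] := leqP (Num.trunc z).+1 (Num.trunc y).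
  by rewrite (eqP le) expn_gt0.
rewrite -(ltr_nat R) natrB ?(ltnW lt)// natrX.
have /andP[tz _] := truncn_itv z0; have ty := trunc_gt_sub1 y.
by rewrite -natr1; lra.
Qed.

Lemma window_coord {R : realType} (n k : nat) (h x : R) : (0 < n)%N -> 0 < h -> 0 <= x ->
  (-1 <= h^-1 * (x - k%:R / n%:R) <= 1) =
  (lo (n%:R * (x - h)) <= k < (Num.trunc (n%:R * (x + h))).+1)%N.
Proof.
move=> n0 h0 x0; have n0' : 0 < n%:R :> R by rewrite ltr0n.
rewrite lo_le ltnS truncn_ge_nat; last by rewrite mulr_ge0// addr_ge0// ltW.
have E : h^-1 * (x - k%:R / n%:R) = (n%:R * x - k%:R) / (n%:R * h).
  by field; rewrite !gt_eqF.
have nh : 0 < n%:R * h by rewrite mulr_gt0.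
rewrite E ler_pdivlMr// ler_pdivrMr// mulN1r mul1r mulrBr mulrDr.
by apply/andP/andP => -[? ?]; split; lra.
Qed.

Lemma cube11_window {R : realType} d n (h : R) (x : 'rV[R]_d) (i : {ffun 'I_d -> 'I_n}) :
  (0 < n)%N -> 0 < h -> cube01 x ->
  cube11 (h^-1 *: (x - grid_pt i)) <->
  [forall l, (lo (n%:R * (x ord0 l - h)) <= (i l).+1 < (Num.trunc (n%:R * (x ord0 l + h))).+1)%N].
Proof.
move=> n0 h0 x01.
have E l : (h^-1 *: (x - grid_pt i)) ord0 l = h^-1 * (x ord0 l - (i l).+1%:R / n%:R).
  by rewrite !mxE.
split=> [H|/forallP H l].
  apply/forallP => l; have /andP[x0 _] := x01 l.
  by rewrite -(window_coord (i l).+1 n0 h0 x0) -E; exact: H.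
by have /andP[x0 _] := x01 l; rewrite E (window_coord (i l).+1 n0 h0 x0).
Qed.

Lemma predn_sub_inj (t a b : nat) : (a < t)%N -> (b < t)%N ->
  (t - a).-1 = (t - b).-1 -> a = b.
Proof. lia. Qed.

Lemma predn_sub_lt (t n a : nat) : (a < t)%N -> (t <= n)%N -> ((t - a).-1 < n)%N.
Proof. lia. Qed.

Section Kernel.
Context {R : realType} {d : nat}.
Variables (K : 'rV[R]_d -> R) (eta c C : R).
Hypothesis K0 : forall x, 0 <= K x.
Hypothesis Ksupp : forall x, ~ cube11 x -> K x = 0.
Hypothesis eta0 : 0 < eta.
Hypothesis Klip : forall x y, cube11 x -> cube11 y -> `|K x - K y| <= eta * supnorm (x - y).
Hypothesis c0 : 0 < c.
Hypothesis Kbd : forall x, cube11 x -> c <= K x <= C.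
Variables (n M N : nat) (h : R).
Hypothesis n0 : (0 < n)%N.
Hypothesis h0 : 0 < h.
Local Notation index := {ffun 'I_d -> 'I_n}.
Local Notation mesh := {ffun 'I_d -> 'I_M.+1}.
Local Notation level := {ffun 'I_d -> 'I_N * bool}.
Local Notation position := {ffun 'I_d -> 'I_(2 ^ N)}.

Definition mesh_pt (m : mesh) : 'rV[R]_d := \row_l ((m l)%:R / M%:R).

(** The left end of the window of the mesh point, rounded down: it precedes the windows of all [x]
    to the right of that point. *)
Definition mesh_base (m : mesh) (l : 'I_d) : nat := Num.trunc (n%:R * (mesh_pt m ord0 l - h)).

Definition mesh_weight (m : mesh) (i : index) : R :=
  K (clampv (h^-1 *: (mesh_pt m - grid_pt i))).

Lemma mesh_weight_norm m i : `|mesh_weight m i| <= C.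
Proof.
have /andP[_] := Kbd (cube11_clampv (h^-1 *: (mesh_pt m - grid_pt i))).
by rewrite ger0_norm /mesh_weight.
Qed.

Lemma kernel_sum_le (x : 'rV[R]_d) (e : index -> R) : (0 < M)%N -> M%:R^-1 <= h ->
  3 * (n%:R * h) + 2 <= 2 ^+ N -> cube01 x ->
  exists m : mesh, exists k : level -> position, (forall J, k J \in admissible J) /\
  `|\sum_i e i * K (h^-1 *: (x - grid_pt i))| <=
    \sum_J `|block_sum (mesh_base m) J (k J) (fun i => e i * mesh_weight m i)|
    + eta / (M%:R * h) * \sum_i `|e i|.
Proof.
move=> M0 Mh hN x01.
have M0' : 0 < M%:R :> R by rewrite ltr0n.
have n0' : 0 < n%:R :> R by rewrite ltr0n.
(* The mesh point is taken below [x], by rounding down each coordinate; [x_l = 1] is why the mesh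
   has [M + 1] values per coordinate. *)
have mx l : (Num.trunc (M%:R * x ord0 l) < M.+1)%N.
  have /andP[_ x1] := x01 l; rewrite ltnS truncn_le_nat -natr1.
  have : M%:R * x ord0 l <= M%:R * 1 by rewrite ler_wpM2l// ltW.
  by lra.
pose m : mesh := [ffun l => Ordinal (mx l)].
pose u l := lo (n%:R * (x ord0 l - h)).
pose v l := (Num.trunc (n%:R * (x ord0 l + h))).+1.
have yx l : mesh_pt m ord0 l <= x ord0 l <= mesh_pt m ord0 l + M%:R^-1.
  have /andP[x0 _] := x01 l.
  have /andP[t1 t2] := truncn_itv (mulr_ge0 (ltW M0') x0).
  rewrite mxE ffunE /= -[X in _ + X]mul1r -mulrDl ler_pdivrMr// ler_pdivlMr//.
  by rewrite [x _ _ * _]mulrC t1 natr1 ltW.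
have bu l : (mesh_base m l <= u l)%N.
  by apply: trunc_le_lo; rewrite ler_wpM2l// lerD2r; have /andP[] := yx l.
(* The span is [n (x - y + 2 h)], at most [3 n h] because [x - y <= 1 / M <= h]. *)
have vN l : (v l - mesh_base m l < 2 ^ N)%N.
  have /andP[x0 _] := x01 l; have /andP[_ xy] := yx l.
  apply: window_span; first by rewrite mulr_ge0 ?addr_ge0// ltW.
  apply: le_trans hN; by rewrite lerD2r -mulrBr mulrCA ler_wpM2l//; lra.
have [k [kJ kle]] := @window_sum_le d n N R (mesh_base m) u v
  (fun i => e i * mesh_weight m i) bu vN.
exists m, k; split=> //.
pose win (i : index) := [forall l, (u l <= (i l).+1 < v l)%N].
(* Outside the window both terms vanish. Inside, [K] is evaluated at two points of the cube whose
   coordinates differ by at most [1 / (M h)]. *)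
have Kwin (i : index) : `|K (h^-1 *: (x - grid_pt i)) - mesh_weight m i * (win i)%:R| <=
    eta / (M%:R * h).
  have e0 : 0 <= eta / (M%:R * h) by rewrite divr_ge0 ?mulr_ge0 ?ltW.
  have [wi|wi] := boolP (win i); last first.
    rewrite mulr0 subr0 Ksupp ?normr0// => /(cube11_window _ n0 h0 x01) H.
    by move: wi; rewrite /win H.
  have cx : cube11 (h^-1 *: (x - grid_pt i)) by apply/(cube11_window _ n0 h0 x01).
  rewrite mulr1; apply: le_trans (Klip cx (cube11_clampv _)) _.
  rewrite ler_wpM2l ?(ltW eta0)//; apply: supnorm_le => [|l].
    by rewrite invr_ge0 mulr_ge0 ?ltW.
  have := cx l; rewrite !mxE => /clamp_id {1}<-.
  apply: le_trans (clamp_lipschitz _ _) _.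
  rewrite -mulrBr normrM gtr0_norm ?invr_gt0// invfM mulrC ler_wpM2r ?invr_ge0 ?(ltW h0)//.
  have := yx l; rewrite mxE => /andP[y1 y2].
  rewrite (_ : _ - _ = x ord0 l - (m l)%:R / M%:R); last by ring.
  by rewrite ger0_norm; lra.
have -> : \sum_i e i * K (h^-1 *: (x - grid_pt i)) =
   \sum_i e i * mesh_weight m i * (win i)%:R +
   \sum_i e i * (K (h^-1 *: (x - grid_pt i)) - mesh_weight m i * (win i)%:R).
  by rewrite -big_split; apply: eq_bigr => i _ /=; ring.
apply: le_trans (ler_normD _ _) _; rewrite lerD//.
apply: le_trans (ler_norm_sum _ _ _) _; rewrite mulr_sumr; apply: ler_sum => i _.
by rewrite normrM mulrC ler_wpM2r.
Qed.

(** As [h <= 1/2], one half of the window stays inside [[0, 1]]: the right half if [x <= 1/2], the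
    left half otherwise. It contains at least [f = trunc (n h)] sites. *)
Lemma window_card (x : R) : h <= 2^-1 -> 1 <= n%:R * h -> 0 <= x <= 1 ->
  n%:R * h / 2 <= #|[pred k : 'I_n |
    (lo (n%:R * (x - h)) <= k.+1 < (Num.trunc (n%:R * (x + h))).+1)%N]|%:R.
Proof.
move=> h1 nh1 /andP[x0 x1].
have n0' : 0 < n%:R :> R by rewrite ltr0n.
have nh0 : 0 <= n%:R * h by rewrite mulr_ge0// ltW.
set W := [pred k : 'I_n | _]; set f := Num.trunc (n%:R * h).
set t := Num.trunc (n%:R * x).
have nx0 : 0 <= n%:R * x by rewrite mulr_ge0// ltW.
have /andP[f1 f2] : f%:R <= n%:R * h < f.+1%:R by exact: truncn_itv.
have /andP[t1 t2] : t%:R <= n%:R * x < t.+1%:R by exact: truncn_itv.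
have f0 : (0 < f)%N by rewrite /f truncn_gt0.
have nxn : n%:R * x <= n%:R by rewrite ler_piMr// ltW.
(* From [f >= 1] and [n h < f + 1] follows [n h / 2 <= f]. *)
suff fW : (f <= #|W|)%N.
  apply: (@le_trans _ _ f%:R); last by rewrite ler_nat.
  have f1' : 1 <= f%:R :> R by rewrite ler1n.
  by rewrite -natr1 in f2; lra.
have inW (k : 'I_n) : k \in W = (n%:R * (x - h) <= k.+1%:R <= n%:R * (x + h)).
  by rewrite inE lo_le ltnS truncn_ge_nat// mulr_ge0// addr_ge0// ltW.
have [xhalf|xhalf] := leP x 2^-1.
  have tn (j : 'I_f) : (t + j < n)%N.
    rewrite -(ltr_nat R) natrD; have jf : j.+1%:R <= f%:R :> R by rewrite ler_nat.
    have H : n%:R * x + n%:R * h <= n%:R * (2^-1 + 2^-1).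
      by rewrite -mulrDr ler_wpM2l// lerD.
    rewrite (_ : 2^-1 + 2^-1 = 1) ?mulr1 in H; last by field.
    by rewrite -natr1 in jf; lra.
  (* The sites [t + 1, ..., t + f], whose indices start at [t]. *)
  pose F (j : 'I_f) : 'I_n := Ordinal (tn j).
  rewrite -[leqLHS]card_ord -(card_imset (f := F)); last first.
    by move=> j j' /(congr1 val)/= /addnI /val_inj.
  apply: subset_leq_card; apply/fintype.subsetP => _ /imsetP[j _ ->].
  rewrite inW /= -natr1 natrD mulrBr mulrDr.
  have jf : j.+1%:R <= f%:R :> R by rewrite ler_nat.
  have j0 : 0 <= j%:R :> R by [].
  by rewrite -natr1 in jf; rewrite -natr1 in t2; apply/andP; split; lra.
have nhx : n%:R * h <= n%:R * x by rewrite ler_wpM2l//; lra.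
have ft : (f <= t)%N by exact: le_truncn.
have tn' : (t <= n)%N by rewrite -(ler_nat R); lra.
have tn (j : 'I_f) : ((t - j).-1 < n)%N.
  exact: predn_sub_lt (leq_trans (ltn_ord j) ft) tn'.
(* The sites [t - f + 1, ..., t], in decreasing order. *)
pose F (j : 'I_f) : 'I_n := Ordinal (tn j).
rewrite -[leqLHS]card_ord -(card_imset (f := F)); last first.
  move=> j j' /(congr1 val)/= H; apply: val_inj.
  exact: predn_sub_inj (leq_trans (ltn_ord j) ft) (leq_trans (ltn_ord j') ft) H.
apply: subset_leq_card; apply/fintype.subsetP => _ /imsetP[j _ ->].
have jt : (j < t)%N := leq_trans (ltn_ord j) ft.
rewrite inW /= prednK ?subn_gt0// natrB ?(ltnW jt)// mulrBr mulrDr.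
have jf : j.+1%:R <= f%:R :> R by rewrite ler_nat.
have j0 : 0 <= j%:R :> R by [].
by rewrite -natr1 in jf; rewrite -natr1 in t2; apply/andP; split; lra.
Qed.

(** The sites in the window form a product set with at least [n h / 2] choices per coordinate, and
    [K] is at least [c] at each of them. *)
Lemma kernel_denominator_ge (x : 'rV[R]_d) : h <= 2^-1 -> 1 <= n%:R * h -> cube01 x ->
  c * (n%:R * h / 2) ^+ d <= \sum_(i : index) K (h^-1 *: (x - grid_pt i)).
Proof.
move=> h1 nh1 x01.
pose W (l : 'I_d) := [pred k : 'I_n |
    (lo (n%:R * (x ord0 l - h)) <= k.+1 < (Num.trunc (n%:R * (x ord0 l + h))).+1)%N].
have nh0 : 0 <= n%:R * h / 2 by lra.
apply: (@le_trans _ _ (\sum_(i : index | i \in family W) c)); last first.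
  rewrite big_mkcond; apply: ler_sum => i _; case: ifP => // /familyP iW.
  have cx : cube11 (h^-1 *: (x - grid_pt i)).
    by apply/(cube11_window _ n0 h0 x01)/forallP => l; exact: iW.
  by have /andP[] := Kbd cx.
rewrite sumr_const -[c *+ _]mulr_natr ler_wpM2l ?(ltW c0)//.
rewrite card_family foldrE big_image/= natr_prod -[leLHS]mulr1.
rewrite -{1}(card_ord d) -prodr_const mulr1; apply: ler_prod => l _.
by rewrite nh0; exact: window_card.
Qed.

End Kernel.

(** * Bound on the supremum for fixed n *)

Lemma powR_prod {R : realType} (I : finType) (F : I -> R) r : (forall l, 0 <= F l) ->
  (\prod_l F l) `^ r = \prod_l F l `^ r.
Proof.
move=> F0; suff [] : 0 <= \prod_l F l /\ (\prod_l F l) `^ r = \prod_l F l `^ r by [].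
elim/big_rec2: _ => [|l y x _ [x0 <-]]; first by rewrite ler01 powR1.
by rewrite mulr_ge0// powRM.
Qed.

Section LnormFacts.
Context {dT : measure_display} {T : measurableType dT} {R : realType}.
Variables (P : probability T R) (q : R).
Hypothesis q0 : 0 < q.
Local Notation p := (q + 2).

Let p0 : 0 < p. Proof. by rewrite addr_gt0. Qed.

Lemma Lnorm_moment X : inLp P q X ->
  Lnorm P p%:E (EFin \o X) = (moment P q X `^ p^-1)%:E.
Proof.
move=> [mX iX]; rewrite unlock.
have E w : (`|(EFin \o X) w| `^ p)%E = (`|X w| `^ p)%:E by [].
by under eq_integral do rewrite E; rewrite -EFin_Rintegral.
Qed.

(* Holds without measurability: the library's integral is a supremum over simple functions. *)
Lemma le_Lnorm (f g : T -> \bar R) : (forall w, 0 <= f w)%E -> (forall w, f w <= g w)%E ->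
  (Lnorm P p%:E f <= Lnorm P p%:E g)%E.
Proof.
move=> f0 fg; rewrite unlock.
have pV : 0 <= p^-1 by rewrite invr_ge0 ltW.
have I0 (u : T -> \bar R) : (0 <= \int[P]_w `|u w| `^ p)%E.
  by apply: integral_ge0 => w _; exact: poweR_ge0.
apply: (gt0_ler_poweR pV); rewrite ?in_itv/= ?leey ?andbT//.
rewrite !ge0_integralTE; try by move=> w; exact: poweR_ge0.
apply: le_ereal_sup => _ [u /= uf <-]; exists u => // w.
apply: le_trans (uf w) _; apply: (gt0_ler_poweR (ltW p0));
  rewrite ?in_itv/= ?leey ?andbT ?abse_ge0//.
by rewrite !gee0_abs// (le_trans (f0 w)).
Qed.

Lemma Lnorm_sum_le (I : Type) (s : seq I) (X : I -> T -> R) :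
  (forall i, measurable_fun setT (X i)) ->
  (Lnorm P p%:E (EFin \o (fun w => \sum_(i <- s) X i w)%R) <=
   \sum_(i <- s) Lnorm P p%:E (EFin \o X i))%E.
Proof.
move=> mX; elim: s => [|i s IH].
  rewrite big_nil (_ : (_ \o _) = cst 0%E); last first.
    by apply/funext => w /=; rewrite big_nil.
  by rewrite Lnorm0// gt_eqF.
rewrite big_cons (_ : (fun w => _) = (X i \+ (fun w => \sum_(j <- s) X j w))%R); last first.
  by apply/funext => w /=; rewrite big_cons.
have p1 : 1 <= p by rewrite (@le_trans _ _ 2) ?ler1n// lerDr ltW.
apply: le_trans (minkowski_EFin P (mX i) (measurable_sum s mX) p1) _.
by rewrite leeD2l.
Qed.

End LnormFacts.

Lemma powR_exprn {R : realType} (x r : R) k : 0 <= x -> (x ^+ k) `^ r = (x `^ r) ^+ k.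
Proof. by move=> x0; rewrite -powR_mulrn// powRAC powR_mulrn// powR_ge0. Qed.

(** Factorization of [t^N - s^N]; since [s < t], the terms with [j] near [N] dominate and the sum is
    of order [t^N]. *)
Lemma sum_geometric_le {R : realType} (s t : R) N : 0 <= s -> s < t ->
  \sum_(j < N) s ^+ (N - j) * t ^+ j <= s / (t - s) * t ^+ N.
Proof.
move=> s0 st; have ts : 0 < t - s by rewrite subr_gt0.
have -> : \sum_(j < N) s ^+ (N - j) * t ^+ j = s * \sum_(j < N) s ^+ (N.-1 - j) * t ^+ j.
  rewrite mulr_sumr; apply: eq_bigr => j _; rewrite mulrA -exprS; congr (_ ^+ _ * _).
  by rewrite -subSn ?prednK//; [case: N j => // -[]|have := ltn_ord j; case: N j].
rewrite -[leRHS]mulrA ler_wpM2l// mulrC ler_pdivlMr// mulrC.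
have := subrXX s t N; set S := \sum_(j < N) _ => E.
have -> : (t - s) * S = t ^+ N - s ^+ N by rewrite -opprB mulNr -E opprB.
by rewrite gerBl exprn_ge0.
Qed.

(** * Domination of the deviation by a random variable independent of [x] *)

Section Assembly.
Context {d : nat} {dT : measure_display} {T : measurableType dT} {R : realType}.
Variables (P : probability T R) (eps : 'rV[int]_d -> T -> R) (q D : R).
Hypothesis q0 : 0 < q.
Local Notation p := (q + 2).
Hypothesis epsLp : forall i, inLp P q (eps i).
Hypothesis eps_moment : forall i, moment P q (eps i) = moment P q (eps 0).
Hypothesis eps_centered : forall i, (\int[P]_w (eps i w)%:E = 0)%E.
Hypothesis D0 : 0 <= D.
Hypothesis momentD : forall (I : finType) (s : I -> 'rV[int]_d) (a : I -> R), injective s ->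
  moment P q (site_sum eps s a [set: I]%SET) <= (D * \sum_i a i ^+ 2) `^ (p / 2).

Variables (K : 'rV[R]_d -> R) (eta c C : R).
Hypothesis K0 : forall x, 0 <= K x.
Hypothesis Ksupp : forall x, ~ cube11 x -> K x = 0.
Hypothesis eta0 : 0 < eta.
Hypothesis Klip : forall x y, cube11 x -> cube11 y -> `|K x - K y| <= eta * supnorm (x - y).
Hypothesis c0 : 0 < c.
Hypothesis Kbd : forall x, cube11 x -> c <= K x <= C.
Variables (n M N : nat) (h : R).
Hypothesis n0 : (0 < n)%N.
Hypothesis h0 : 0 < h.
Local Notation index := {ffun 'I_d -> 'I_n}.
Local Notation mesh := {ffun 'I_d -> 'I_M.+1}.
Local Notation level := {ffun 'I_d -> 'I_N * bool}.
Local Notation position := {ffun 'I_d -> 'I_(2 ^ N)}.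

Let p0 : 0 < p. Proof. by rewrite addr_gt0. Qed.

Lemma grid_idx_inj : injective (@grid_idx d n).
Proof.
move=> i j /rowP ij; apply/ffunP => l; apply: val_inj.
by have := ij l; rewrite !mxE => -[].
Qed.

Let blk (m : mesh) (J : level) (k : position) (w : T) : R :=
  block_sum (mesh_base n h m) J k (fun i : index => eps (grid_idx i) w * mesh_weight K h m i).

Let blkE m J k : blk m J k = site_sum eps (@grid_idx d n)
  (fun i => mesh_weight K h m i * (in_block (mesh_base n h m) J k i)%:R) [set: index]%SET.
Proof.
apply/funext => w; rewrite /blk /block_sum /site_sum [RHS]big_mkcond/=.
by apply: eq_bigr => i _; rewrite inE; ring.
Qed.

Let blk_inLp m J k : inLp P q (blk m J k).
Proof. by rewrite blkE; apply: inLp_sum => // i; exact: inLpZ. Qed.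

Let blk_moment m J k :
  moment P q (blk m J k) <= (D * C ^+ 2 * \prod_l (2 ^+ (J l).1)) `^ (p / 2).
Proof.
rewrite blkE; apply: le_trans (momentD _ (@grid_idx_inj)) _.
have s0 : 0 <= \sum_(i : index) (mesh_weight K h m i * (in_block (mesh_base n h m) J k i)%:R) ^+ 2.
  by apply: sumr_ge0 => i _; exact: sqr_ge0.
apply: le_powR; [by rewrite divr_ge0 ?ltW|by rewrite mulr_ge0|].
rewrite -mulrA ler_wpM2l//.
apply: (@le_trans _ _ (\sum_(i : index) C ^+ 2 * (in_block (mesh_base n h m) J k i)%:R)).
  apply: ler_sum => i _; case: (in_block _ _ _ _); last by rewrite !mulr0 expr0n.
  rewrite !mulr1 -real_normK ?num_real// ler_sqr ?nnegrE ?(mesh_weight_norm K0 Kbd)//.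
  exact: le_trans (normr_ge0 _) (mesh_weight_norm K0 Kbd h m i).
by rewrite -mulr_sumr ler_wpM2l ?sqr_ge0// sum_in_block_le.
Qed.

(** The [l^p] norm over mesh points and admissible positions: it dominates every block of level [J],
    and its p-th moment is a finite sum of block moments. *)
Let blkmax (J : level) (w : T) : R :=
  (\sum_(mk : mesh * position | mk.2 \in admissible J) `|blk mk.1 J mk.2 w| `^ p) `^ p^-1.

Let blk_le_max m J k w : k \in admissible J -> `|blk m J k w| <= blkmax J w.
Proof.
move=> kJ; rewrite /blkmax.
have -> : `|blk m J k w| = (`|blk m J k w| `^ p) `^ p^-1.
  by rewrite -powRrM mulfV ?gt_eqF// powRr1.
apply: le_powR; [by rewrite invr_ge0 ltW|exact: powR_ge0|].
rewrite (bigD1 (m, k))//= lerDl; apply: sumr_ge0 => mk _; exact: powR_ge0.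
Qed.

Let blkmax_ge0 J w : 0 <= blkmax J w. Proof. exact: powR_ge0. Qed.

Let blkmax_pow J w : `|blkmax J w| `^ p =
  \sum_(mk : mesh * position | mk.2 \in admissible J) `|blk mk.1 J mk.2 w| `^ p.
Proof.
rewrite ger0_norm// /blkmax -powRrM mulVf ?gt_eqF// powRr1//.
by apply: sumr_ge0 => mk _; exact: powR_ge0.
Qed.

Let measurable_blk_pow J : measurable_fun setT (fun w =>
  \sum_(mk : mesh * position | mk.2 \in admissible J) `|blk mk.1 J mk.2 w| `^ p).
Proof.
under eq_fun do rewrite big_mkcond.
apply: measurable_sum => mk; case: (_ \in _) => //.
by apply: measurable_abs_powR; case: (blk_inLp mk.1 J mk.2).
Qed.

Let int_blkmax J : (\int[P]_w (`|blkmax J w| `^ p)%:E =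
  (\sum_(mk : mesh * position | mk.2 \in admissible J) moment P q (blk mk.1 J mk.2))%:E)%E.
Proof.
under eq_integral do rewrite blkmax_pow -sumEFin.
rewrite (@integral_sum _ T R P setT measurableT _
  (fun (mk : mesh * position) w => (`|blk mk.1 J mk.2 w| `^ p)%:E)).
  rewrite -sumEFin; apply: eq_bigr => mk _.
  by rewrite -EFin_Rintegral//; case: (blk_inLp mk.1 J mk.2).
by move=> mk; case: (blk_inLp mk.1 J mk.2).
Qed.

Let blkmax_inLp J : inLp P q (blkmax J).
Proof.
split; first by apply: (measurableT_comp (measurable_powR _)); exact: measurable_blk_pow.
apply/integrableP; split.
  apply/measurable_EFinP; under eq_fun do rewrite blkmax_pow.
  exact: measurable_blk_pow.
under eq_integral do rewrite gee0_abs ?lee_fin ?powR_ge0//.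
by rewrite int_blkmax ltry.
Qed.

(** One coordinate's share at length [2^j]: the number of positions to the power [1 / p], times the
    square root of the block length. *)
Let level_weight (j : 'I_N) : R := (2 ^+ (N - j)) `^ p^-1 * (2 ^+ j) `^ 2^-1.

Let Lnorm_blkmax J : (Lnorm P p%:E (EFin \o blkmax J) <=
  ((M.+1%:R ^+ d) `^ p^-1 * (D * C ^+ 2) `^ 2^-1 * \prod_l level_weight (J l).1)%:E)%E.
Proof.
rewrite Lnorm_moment// lee_fin.
have DC0 : 0 <= D * C ^+ 2 by rewrite mulr_ge0// sqr_ge0.
have pr0 : 0 <= \prod_(l < d) (2 ^+ (J l).1) :> R by apply: prodr_ge0 => l _; exact: exprn_ge0.
have pr0' : 0 <= \prod_(l < d) (2 ^+ (N - (J l).1)) :> R by apply: prodr_ge0 => l _; exact: exprn_ge0.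
set B := (D * C ^+ 2 * \prod_l (2 ^+ (J l).1)) `^ (p / 2).
have B0 : 0 <= B by exact: powR_ge0.
have mB : moment P q (blkmax J) <= M.+1%:R ^+ d * \prod_l (2 ^+ (N - (J l).1)) * B.
  rewrite /moment /Rintegral int_blkmax/=.
  apply: (@le_trans _ _ (\sum_(mk : mesh * position | mk.2 \in admissible J) B)).
    by apply: ler_sum => mk _; exact: blk_moment.
  rewrite -(pair_big xpredT (fun k => k \in admissible J) (fun _ _ => B))/=.
  rewrite !sumr_const -mulrnA -[leLHS]mulr_natl natrM ler_wpM2r// mulrC.
  have -> : #|{: mesh}|%:R = M.+1%:R ^+ d :> R by rewrite card_ffun !card_ord natrX.
  rewrite ler_wpM2l ?exprn_ge0//; exact: card_admissible_le.
apply: (@le_trans _ _ ((M.+1%:R ^+ d * \prod_l (2 ^+ (N - (J l).1)) * B) `^ p^-1)).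
  by apply: le_powR => //; [rewrite invr_ge0 ltW|exact: moment_ge0].
rewrite powRM ?mulr_ge0 ?exprn_ge0// powRM ?exprn_ge0//.
rewrite /level_weight big_split/= /B -powRrM (_ : p / 2 * p^-1 = 2^-1); last first.
  by field; rewrite gt_eqF.
rewrite powRM// !powR_prod; try by move=> l; exact: exprn_ge0.
by rewrite le_eqVlt; apply/orP; left; apply/eqP; ring.
Qed.

(** The constant of [sum_geometric_le] for [s = 2^(1/p)] and [t = 2^(1/2)]; [s < t] because
    [p > 2]. *)
Let dyadic_const : R := 2 `^ p^-1 / (2 `^ 2^-1 - 2 `^ p^-1).

Let pV_lt : p^-1 < 2^-1.
Proof. by rewrite ltf_pV2 ?posrE// ltrDr. Qed.

Let sum_level_weight : \sum_(j < N) level_weight j <= dyadic_const * (2 ^+ N) `^ 2^-1.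
Proof.
rewrite /level_weight; under eq_bigr do rewrite !powR_exprn//.
rewrite powR_exprn//; apply: sum_geometric_le; first exact: powR_ge0.
by rewrite /powR pnatr_eq0/= ltr_expR ltr_pM2r// ln_gt0// ltr1n.
Qed.

Let level_weight_ge0 j : 0 <= level_weight j.
Proof. by rewrite mulr_ge0// powR_ge0. Qed.

(** The sum over level vectors factors into [d] one-dimensional sums; the factor 2 counts the two
    endpoints of the window. *)
Let sum_levels : \sum_(J : level) \prod_l level_weight (J l).1 <=
  (2 * (dyadic_const * (2 ^+ N) `^ 2^-1)) ^+ d.
Proof.
rewrite -(bigA_distr_bigA (fun _ js => level_weight js.1)) prodr_const card_ord.
have -> : \sum_(js : 'I_N * bool) level_weight js.1 = 2 * \sum_(j < N) level_weight j.
  rewrite -(pair_bigA _ (fun (j : 'I_N) (_ : bool) => level_weight j))/= mulr_sumr.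
  by apply: eq_bigr => j _; rewrite big_bool/= mulr_natl mulr2n.
have S0 : 0 <= \sum_(j < N) level_weight j by exact: sumr_ge0.
have X0 := le_trans S0 sum_level_weight.
have SX : 2 * \sum_(j < N) level_weight j <= 2 * (dyadic_const * (2 ^+ N) `^ 2^-1).
  by rewrite ler_wpM2l.
by apply: lerXn2r => //; rewrite nnegrE; apply: mulr_ge0.
Qed.

Let kappa : R := eta / (M%:R * h).

Let noise (w : T) : R := \sum_(i : index) `|eps (grid_idx i) w|.

(** Dominates the numerator of the deviation simultaneously for all [x]: block maxima for the
    clamped kernel, and [kappa * noise] for the mesh error, summed over the whole grid. *)
Let majorant (w : T) : R := \sum_(J : level) blkmax J w + kappa * noise w.

Let abs_inLp X : inLp P q X -> inLp P q (fun w => `|X w|).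
Proof.
move=> [mX iX]; split; first exact: measurableT_comp.
by under eq_fun do rewrite normr_id.
Qed.

Let sum_blkmax_inLp : inLp P q (fun w => \sum_(J : level) blkmax J w).
Proof.
have := @inLp_sum _ T R P q q0 level [set: level]%SET blkmax blkmax_inLp.
rewrite (_ : (fun w => \sum_(J in _) _) = fun w => \sum_J blkmax J w)//.
by apply/funext => w; rewrite big_mkcond; apply: eq_bigr => J _; rewrite inE.
Qed.

Let noise_inLp : inLp P q noise.
Proof.
have := @inLp_sum _ T R P q q0 index [set: index]%SET
  (fun i w => `|eps (grid_idx i) w|) (fun i => abs_inLp (epsLp _)).
rewrite (_ : (fun w => \sum_(i in _) _) = noise)//.
by apply/funext => w; rewrite big_mkcond; apply: eq_bigr => i _; rewrite inE.
Qed.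

Let majorant_inLp : inLp P q majorant.
Proof. by apply: inLpD => //; exact: inLpZ. Qed.

Let LnormZ_inLp a X : 0 <= a -> inLp P q X ->
  Lnorm P p%:E (EFin \o (fun w => a * X w)) = (a%:E * Lnorm P p%:E (EFin \o X))%E.
Proof.
move=> a0 iX; rewrite !Lnorm_moment//; last exact: inLpZ.
rewrite momentZ// powRM ?powR_ge0 ?moment_ge0// -powRrM mulfV ?gt_eqF// powRr1//.
by rewrite ger0_norm// EFinM.
Qed.

Definition block_bound : R := (M.+1%:R ^+ d) `^ p^-1 * (D * C ^+ 2) `^ 2^-1 *
  (2 * (dyadic_const * (2 ^+ N) `^ 2^-1)) ^+ d.

Definition noise_bound : R := kappa * (n%:R ^+ d * moment P q (eps 0) `^ p^-1).

Let kappa_ge0 : 0 <= kappa.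
Proof. by rewrite /kappa divr_ge0 ?mulr_ge0// ltW. Qed.

Let Lnorm_majorant :
  (Lnorm P p%:E (EFin \o majorant) <= (block_bound + noise_bound)%:E)%E.
Proof.
have p1 : 1 <= p by rewrite (@le_trans _ _ 2) ?ler1n// lerDr ltW.
have -> : majorant = ((fun w => \sum_(J : level) blkmax J w) \+ (fun w => kappa * noise w))%R.
  by [].
apply: le_trans (minkowski_EFin P sum_blkmax_inLp.1 (inLpZ kappa noise_inLp).1 p1) _.
rewrite [leRHS]EFinD; apply: leeD.
  apply: le_trans (Lnorm_sum_le P q0 (index_enum level) (fun J => (blkmax_inLp J).1)) _.
  apply: le_trans (lee_sum _ (fun J _ => Lnorm_blkmax J)) _.
  by rewrite sumEFin lee_fin -mulr_sumr ler_wpM2l ?mulr_ge0 ?powR_ge0// sum_levels.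
rewrite LnormZ_inLp// /noise_bound [leRHS]EFinM; apply: lee_wpmul2l; first by rewrite lee_fin.
have mabs (i : index) : measurable_fun setT (fun w => `|eps (grid_idx i) w|).
  exact: (abs_inLp (epsLp _)).1.
apply: le_trans (Lnorm_sum_le P q0 (index_enum index) mabs) _.
rewrite (eq_bigr (fun=> (moment P q (eps 0) `^ p^-1)%:E)); last first.
  move=> i _; rewrite (Lnorm_moment (abs_inLp (epsLp (grid_idx i)))).
  suff -> : moment P q (fun w => `|eps (grid_idx i) w|) = moment P q (eps (grid_idx i)).
    by rewrite eps_moment.
  by apply: eq_Rintegral => w _; rewrite normr_id.
by rewrite sumEFin lee_fin sumr_const card_ffun !card_ord -[leLHS]mulr_natl natrX.
Qed.

Variable g : 'rV[R]_d -> R.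

Let weightsum (x : 'rV[R]_d) : R := \sum_(i : index) K (h^-1 *: (x - grid_pt i)).

Let estimatorE x w : estimator K g eps n h x w =
  (\sum_(i : index) g (grid_pt i) * K (h^-1 *: (x - grid_pt i))) / weightsum x +
  \sum_(i : index) K (h^-1 *: (x - grid_pt i)) / weightsum x * eps (grid_idx i) w.
Proof.
rewrite /estimator; under eq_bigr do rewrite mulrDl.
rewrite big_split/= mulrDl; congr (_ + _); rewrite mulr_suml.
by apply: eq_bigr => i _; rewrite -/(weightsum x); ring.
Qed.

Let eps_integrable i : P.-integrable setT (EFin \o eps i).
Proof.
have [mX iX] := epsLp i.
apply: (@dominated_integrable _ _ _ P _ (fun w => 1 + `|eps i w| `^ p)) => //.
  move=> w; have [le1|/ltW ge1] := leP `|eps i w| 1.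
    by rewrite ler_wpDr// powR_ge0.
  have p1 : 1 <= p by rewrite (@le_trans _ _ 2) ?ler1n// lerDr ltW.
  by rewrite ler_wpDl// le1r_powR.
have := integrableD measurableT (finite_measure_integrable_cst P 1 measurableT) iX.
by apply: eq_integrable => // w _; rewrite /= EFinD.
Qed.

(** The errors are centered, so only the deterministic part of [estimatorE] survives; subtracting it
    leaves a weighted sum of errors. *)
Let expectation_estimator x : ('E_P[estimator K g eps n h x] =
  ((\sum_(i : index) g (grid_pt i) * K (h^-1 *: (x - grid_pt i))) / weightsum x)%:E)%E.
Proof.
rewrite unlock; set al := _ / _.
have iE (i : index) : P.-integrable setT (fun w =>
    (K (h^-1 *: (x - grid_pt i)) / weightsum x)%:E * (eps (grid_idx i) w)%:E)%E.
  by apply: integrableZl => //; exact: eps_integrable.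
under eq_integral do rewrite estimatorE -/al EFinD -sumEFin.
under eq_integral do under eq_bigr do rewrite EFinM.
rewrite integralD//; last 2 first.
- exact: (finite_measure_integrable_cst P al measurableT).
- exact: integrable_sum.
have -> : (\int[P]_w al%:E = al%:E)%E.
  by have := expectation_cst P al; rewrite unlock.
rewrite integral_sum// big1 ?adde0// => i _.
by rewrite integralZl ?eps_centered ?mule0//; exact: eps_integrable.
Qed.

Lemma Lnorm_sup_dev_le : (0 < M)%N -> M%:R^-1 <= h -> 3 * (n%:R * h) + 2 <= 2 ^+ N ->
  h <= 2^-1 -> 1 <= n%:R * h ->
  (Lnorm P p%:E (sup_dev P K g eps n h) <=
    ((c * (n%:R * h / 2) ^+ d)^-1 * (block_bound + noise_bound))%:E)%E.
Proof.
move=> M0 Mh hN h1 nh1.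
set low := c * _ ^+ d.
have low0 : 0 < low by rewrite mulr_gt0// exprn_gt0//; lra.
have dev_le (x : 'rV[R]_d) w : cube01 x ->
    (`| (estimator K g eps n h x w)%:E - 'E_P[estimator K g eps n h x] | <=
     (low^-1 * majorant w)%:E)%E.
  move=> x01; rewrite expectation_estimator estimatorE -EFinB addrAC subrr add0r lee_fin.
  have lowx : low <= weightsum x by exact: (kernel_denominator_ge K0 c0 Kbd n0 h0 h1 nh1 x01).
  have wx0 : 0 < weightsum x by exact: lt_le_trans lowx.
  have -> : \sum_(i : index) K (h^-1 *: (x - grid_pt i)) / weightsum x * eps (grid_idx i) w =
      (weightsum x)^-1 * \sum_(i : index) eps (grid_idx i) w * K (h^-1 *: (x - grid_pt i)).
    by rewrite mulr_sumr; apply: eq_bigr => i _; ring.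
  have [m [k [kJ kle]]] := kernel_sum_le Ksupp eta0 Klip n0 h0 (fun i => eps (grid_idx i) w)
    M0 Mh hN x01.
  rewrite normrM ger0_norm ?invr_ge0 ?(ltW wx0)//.
  have maj0 : 0 <= majorant w.
    by rewrite addr_ge0 ?sumr_ge0// mulr_ge0// sumr_ge0.
  apply: (@le_trans _ _ ((weightsum x)^-1 * majorant w)).
    rewrite ler_wpM2l ?invr_ge0 ?(ltW wx0)//; apply: le_trans kle _.
    by rewrite lerD2r; apply: ler_sum => J _; exact: blk_le_max.
  by rewrite ler_wpM2r// lef_pV2 ?posrE.
have -> : ((low^-1 * (block_bound + noise_bound))%:E =
    low^-1%:E * (block_bound + noise_bound)%:E)%E by rewrite EFinM.
have lV0 : 0 <= low^-1 by rewrite invr_ge0 ltW.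
apply: (@le_trans _ _ (low^-1%:E * Lnorm P p%:E (EFin \o majorant))%E); last first.
  by apply: lee_wpmul2l; rewrite ?lee_fin.
rewrite -LnormZ_inLp//; apply: le_Lnorm => // w.
  (* The supremum is nonnegative because it is taken over a set of absolute values that is nonempty,
     containing the value at [x = 0]. *)
  apply: le_trans (ereal_sup_ubound _); last first.
    by exists 0 => //= l; rewrite mxE lexx ler01.
  exact: abse_ge0.
by apply: ge_ereal_sup => _ [x x01 <-]; exact: dev_le.
Qed.

End Assembly.

(** * Choice of the mesh *)

Lemma moment_inequality {d : nat} {dT : measure_display} {T : measurableType dT} {R : realType}
  (P : probability T R) (eps : 'rV[int]_d -> T -> R) (q : R) :
  0 < q -> (forall i, measurable_fun setT (eps i)) -> strictly_stationary P eps ->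
  inLp P q (eps 0) -> condition_C3 P eps (q + 2) ->
  exists2 D : R, 0 <= D & forall (I : finType) (s : I -> 'rV[int]_d) (a : I -> R), injective s ->
    moment P q (site_sum eps s a [set: I]%SET) <= (D * \sum_i a i ^+ 2) `^ ((q + 2) / 2).
Proof.
move=> q0 meps stat eps0Lp [_ [Y [condE sumc]]].
exists ((2 * ((q + 2) * (2 * (q + 1)) + (q + 2) * (q + 2 - 1) * (1 + 2 `^ q)) + 1) *
   (moment P q (eps 0) `^ (2 / (q + 2)) + csum P eps q Y)).
  have cs0 := csum_ge0 P eps q Y.
  have m0 := powR_ge0 (moment P q (eps 0)) (2 / (q + 2)).
  have x0 := powR_ge0 (2 : R) q.
  rewrite mulr_ge0 ?addr_ge0// mulr_ge0// addr_ge0// !mulr_ge0//; lra.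
by move=> I s a sI; exact: (moment_site_sum q0 meps stat eps0Lp condE sumc a sI).
Qed.

Lemma Lnorm_lty_inLp {dT : measure_display} {T : measurableType dT} {R : realType}
  (P : probability T R) (q : R) (X : T -> R) : 0 < q -> measurable_fun setT X ->
  (Lnorm P (q + 2)%:E (EFin \o X) < +oo)%E -> inLp P q X.
Proof.
move=> q0 mX; rewrite unlock => /lty_poweRy fin; split=> //.
apply/integrableP; split; first exact/measurable_EFinP/measurable_abs_powR.
have -> : (\int[P]_w `|(`|X w| `^ (q + 2))%:E| = \int[P]_w `|(EFin \o X) w| `^ (q + 2))%E.
  by apply: eq_integral => w _; rewrite gee0_abs ?lee_fin ?powR_ge0.
by apply: fin; rewrite invr_eq0 gt_eqF// addr_gt0.
Qed.

Lemma stationary_mean {d : nat} {dT : measure_display} {T : measurableType dT} {R : realType}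
  (P : probability T R) (eps : 'rV[int]_d -> T -> R) k :
  (forall i, measurable_fun setT (eps i)) -> strictly_stationary P eps ->
  (\int[P]_w (eps k w)%:E = \int[P]_w (eps 0 w)%:E)%E.
Proof.
move=> meps stat.
have mF : measurable_fun setT (fun f : paths 'rV[int]_d R => (f 0)%:E).
  by apply/measurable_EFinP; exact: measurable_coord.
have := stationary_integral meps stat k mF.
by rewrite /shifted !add0r.
Qed.

(** * Arithmetic of the exponents *)

Section Exponents.
Context {R : realType}.
Variables (d : nat) (a p theta : R).
Hypothesis d1 : (1 <= d)%N.
Hypothesis a0 : 0 < a.
Hypothesis p2 : 2 < p.
Hypothesis thetaE : theta = (2 * a * (d%:R + p) - d%:R ^+ 2) / (d%:R * (3 * d%:R + 2)).
Hypothesis theta0 : 0 < theta.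

Let dR1 : 1 <= d%:R :> R. Proof. by rewrite ler1n. Qed.

Let thetaM : theta * (d%:R * (3 * d%:R + 2)) = 2 * a * (d%:R + p) - d%:R ^+ 2.
Proof.
have ? := dR1; rewrite thetaE divfK// gt_eqF// mulr_gt0//; lra.
Qed.

(** With [M >= n^(ap/d)] and [h >= n^(-theta)] this gives [1 / M <= h], as required for the mesh. *)
Lemma theta_le : theta <= a * p / d%:R.
Proof.
have dp : 0 < d%:R :> R by have := dR1; lra.
rewrite ler_pdivlMr// -(@ler_pM2r _ (3 * d%:R + 2)); last by lra.
rewrite -mulrA thetaM.
have ad : 0 <= a * d%:R by rewrite mulr_ge0 ?ltW.
have H : 0 <= a * d%:R * (p - 2) by rewrite mulr_ge0// subr_ge0 ltW.
have H2 := sqr_ge0 (d%:R : R).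
lra.
Qed.

(** The definition of [theta] amounts to [theta (1 + 3d/2) = ap/d + a - d/2]; weakening [3d/2] to
    [d/2] leaves the inequality that makes the mesh error negligible. *)
Lemma theta_exponent : d%:R <= a * p / d%:R + a + d%:R / 2 - theta * (1 + d%:R / 2).
Proof.
have dp : 0 < d%:R :> R by have := dR1; lra.
have X : theta * (1 + d%:R / 2) <= a * p / d%:R + a - d%:R / 2.
  have -> : a * p / d%:R + a - d%:R / 2 = theta * (d%:R * (3 * d%:R + 2)) / (2 * d%:R).
    by rewrite thetaM; field; rewrite gt_eqF.
  have -> : theta * (d%:R * (3 * d%:R + 2)) / (2 * d%:R) = theta * (3 / 2 * d%:R + 1).
    by field; rewrite gt_eqF.
  rewrite ler_wpM2l ?(ltW theta0)//; lra.
lra.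
Qed.

Variables (n M N : nat) (h : R).
Hypothesis n0 : (0 < n)%N.
Hypothesis nh1 : 1 <= n%:R * h.
Hypothesis h0 : 0 < h.
Hypothesis hth : n%:R `^ (- theta) <= h.
Hypothesis Mlow : n%:R `^ (a * p / d%:R) <= M%:R.
Hypothesis Mup : M.+1%:R <= 3 * n%:R `^ (a * p / d%:R).
Hypothesis Nup : 2 ^+ N <= 12 * (n%:R * h).

Let nR1 : 1 <= n%:R :> R. Proof. by rewrite ler1n. Qed.

Let nR0 : 0 < n%:R :> R. Proof. by rewrite ltr0n. Qed.

Lemma mesh_le_bandwidth : M%:R^-1 <= h.
Proof.
apply: le_trans hth; rewrite powRN lef_pV2 ?posrE ?powR_gt0//.
  by apply: le_trans Mlow; apply: ler_powR => //; exact: theta_le.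
by apply: lt_le_trans Mlow; rewrite powR_gt0.
Qed.

(** After multiplying by [M h], the lower bounds on [M] and on [h^(1 + d/2)] turn the claim into a
    comparison of powers of [n], which is [theta_exponent]. *)
Lemma noise_exponent : n%:R ^+ d / (M%:R * h) <= n%:R `^ a * (n%:R * h) `^ (d%:R / 2).
Proof.
have M0 : 0 < M%:R :> R by apply: lt_le_trans Mlow; rewrite powR_gt0.
rewrite ler_pdivrMr ?mulr_gt0// powRM ?(ltW h0)//.
have n_ne0 : n%:R != 0 :> R by rewrite gt_eqF.
have hpow : n%:R `^ (- theta * (1 + d%:R / 2)) <= h * h `^ (d%:R / 2).
  have -> : h * h `^ (d%:R / 2) = h `^ (1 + d%:R / 2).
    by rewrite powRD ?powRr1 ?(ltW h0)//; apply/implyP; rewrite gt_eqF.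
  by rewrite powRrM; apply: le_powR; rewrite ?powR_ge0// addr_ge0// divr_ge0.
have Mh : n%:R `^ (a * p / d%:R) * n%:R `^ (- theta * (1 + d%:R / 2)) <=
    M%:R * (h * h `^ (d%:R / 2)) by rewrite ler_pM ?powR_ge0.
have W0 : 0 <= n%:R `^ a * n%:R `^ (d%:R / 2) by rewrite mulr_ge0 ?powR_ge0.
have := ler_wpM2l W0 Mh.
rewrite (_ : _ * (M%:R * _) = n%:R `^ a * (n%:R `^ (d%:R / 2) * h `^ (d%:R / 2)) * (M%:R * h));
  last by ring.
apply: le_trans; rewrite -!powRD; try by apply/implyP.
rewrite -powR_mulrn//; apply: ler_powR => //.
by have := theta_exponent; lra.
Qed.

(** Both terms of the numerator are of order [n^a (n h)^(d/2)]; dividing by the denominator, of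
    order [(n h)^d], gives the rate. *)
Lemma deviation_bound (B L m eta c : R) : 0 <= B -> 0 <= L -> 0 <= m -> 0 < eta -> 0 < c ->
  (c * (n%:R * h / 2) ^+ d)^-1 *
   ((M.+1%:R ^+ d) `^ p^-1 * B * (2 * (L * (2 ^+ N) `^ 2^-1)) ^+ d +
    eta / (M%:R * h) * (n%:R ^+ d * m)) <=
  (c^-1 * 2 ^+ d * ((3 ^+ d) `^ p^-1 * B * (2 * (L * 12 `^ 2^-1)) ^+ d + eta * m)) *
   (n%:R `^ a / (n%:R * h) `^ (d%:R / 2)).
Proof.
move=> B0 L0 m0 eta0 c0; set y := n%:R * h.
have y0 : 0 < y by exact: lt_le_trans nh1.
(* Through the square root of [y], all real powers of [y] become natural powers of [s], and [field]
   can conclude. *)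
pose s := y `^ 2^-1; have s0 : 0 < s by exact: powR_gt0.
have yE : y = s ^+ 2.
  by rewrite /s -powR_mulrn ?powR_ge0// -powRrM mulVf ?pnatr_eq0// powRr1// ltW.
have sd : y `^ (d%:R / 2) = s ^+ d.
  by rewrite mulrC powRrM powR_mulrn// powR_ge0.
(* The choice of [M] is made for this: [(n^(ap/d))^(d/p) = n^a]. *)
have H1 : (M.+1%:R ^+ d) `^ p^-1 <= (3 ^+ d) `^ p^-1 * n%:R `^ a.
  apply: (@le_trans _ _ ((3 ^+ d * (n%:R `^ (a * p / d%:R)) ^+ d) `^ p^-1)).
    apply: le_powR; [by rewrite invr_ge0 ltW// (lt_trans _ p2)|exact: exprn_ge0|].
    by rewrite -exprMn; apply: lerXn2r; rewrite ?nnegrE ?mulr_ge0 ?powR_ge0.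
  rewrite powRM ?exprn_ge0 ?powR_ge0// ler_wpM2l ?powR_ge0//.
  rewrite -powR_mulrn ?powR_ge0// -!powRrM.
  rewrite (_ : a * p / d%:R * (d%:R * p^-1) = a)//.
  have dp : 0 < d%:R :> R by exact: lt_le_trans dR1.
  have pp : 0 < p by exact: lt_trans p2.
  by field; rewrite (gt_eqF dp) (gt_eqF pp).
have H2 : (2 * (L * (2 ^+ N) `^ 2^-1)) ^+ d <= (2 * (L * 12 `^ 2^-1)) ^+ d * s ^+ d.
  rewrite -exprMn; apply: lerXn2r; rewrite ?nnegrE ?mulr_ge0 ?powR_ge0 ?(ltW s0)//.
  rewrite -[leRHS]mulrA ler_wpM2l// -mulrA ler_wpM2l//.
  by rewrite -powRM ?(ltW y0)//; apply: le_powR; rewrite ?invr_ge0 ?exprn_ge0.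
have H3 : eta / (M%:R * h) * (n%:R ^+ d * m) <= eta * m * (n%:R `^ a * s ^+ d).
  rewrite (_ : eta / _ * _ = eta * m * (n%:R ^+ d / (M%:R * h))); last by ring.
  by rewrite ler_wpM2l ?mulr_ge0 ?(ltW eta0)// -sd; exact: noise_exponent.
have H4 : (M.+1%:R ^+ d) `^ p^-1 * B * (2 * (L * (2 ^+ N) `^ 2^-1)) ^+ d <=
   (3 ^+ d) `^ p^-1 * n%:R `^ a * B * ((2 * (L * 12 `^ 2^-1)) ^+ d * s ^+ d).
  rewrite ler_pM ?mulr_ge0 ?powR_ge0 ?exprn_ge0 ?mulr_ge0 ?powR_ge0//.
  by rewrite ler_wpM2r.
have low0 : 0 <= (c * (y / 2) ^+ d)^-1.
  by rewrite invr_ge0 mulr_ge0 ?exprn_ge0 ?divr_ge0 ?(ltW c0) ?(ltW y0).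
apply: le_trans (ler_wpM2l low0 (lerD H4 H3)) _.
rewrite sd yE expr_div_n -exprM mulnC exprM expr2 le_eqVlt; apply/orP; left; apply/eqP.
have sdn : s ^+ d != 0 by rewrite expf_neq0// gt_eqF.
have tdn : 2 ^+ d != 0 :> R by rewrite expf_neq0// pnatr_eq0.
by field; rewrite sdn tdn gt_eqF.
Qed.

End Exponents.

Lemma dyadic_size {R : realType} (y : R) : 1 <= y -> exists N : nat,
  3 * y + 2 <= 2 ^+ N /\ 2 ^+ N <= 12 * y.
Proof.
move=> y1; set A := (Num.trunc (3 * y + 2)).+1.
have z0 : 0 <= 3 * y + 2 by lra.
have /andP[t1 t2] := truncn_itv z0.
have A1 : (1 < A)%N by rewrite /A ltnS truncn_gt0; lra.
have /andP[u1 u2] := up_log_bounds (isT : (1 < 2)%N) A1.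
exists (up_log 2 A); split.
  by apply: le_trans (ltW t2) _; rewrite -natrX ler_nat.
have AR : A%:R <= 3 * y + 3 by rewrite /A -natr1; lra.
(* By minimality [2^(N - 1) < A], so [2^N <= 2 A <= 6 y + 6 <= 12 y], the last step by [y >= 1]. *)
have uA : (2 ^ (up_log 2 A) <= 2 * A)%N.
  apply: leq_trans (leq_mul (leqnn 2) (ltnW u1)); rewrite -expnS leq_exp2l//.
  by case: (up_log 2 A).
rewrite -natrX; apply: (@le_trans _ _ (2 * A)%:R); first by rewrite ler_nat.
by rewrite natrM; lra.
Qed.

Unset Implicit Arguments.
Set Strict Implicit.

Theorem theorem2
  (d : nat) (dT : measure_display) (T : measurableType dT) (R : realType)
  (P : probability T R)
  (eps : 'rV[int]_d -> {RV P >-> R})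
  (g : 'rV[R]_d -> R) (K : 'rV[R]_d -> R) (h : nat -> R) (p a : R) :
  (1 <= d)%N ->
  strictly_stationary P (fun i => eps i : T -> R) ->
  ('E_P[eps (0 : 'rV[int]_d)%R] = 0)%E ->
  prob_density K ->
  (forall n, 0 < h n) ->
  h @ \oo --> 0 ->
  (fun n => n%:R * h n) @ \oo --> +oo ->
  assumption_A1 K ->
  2 < p ->
  condition_C3 P (fun i => eps i : T -> R) p ->
  0 < a ->
  let theta := (2 * a * (d%:R + p) - d%:R ^+ 2) / (d%:R * (3 * d%:R + 2)) in
  let v := fun n : nat => n%:R `^ a / (n%:R * h n) `^ (d%:R / 2) in
  0 < theta ->
  (forall n : nat, (0 < n)%N -> n%:R `^ (- theta) <= h n) ->
  exists C : R, \forall n \near \oo,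
    (Lnorm P p%:E
       (sup_dev P K g (fun i => eps i : T -> R) n (h n))
     <= (C * v n)%:E)%E.
Proof.
move=> d1 stat E0 _ h0 hcv nhcv [_ K0 Ksupp [eta [eta0 Klip]] [c [C [c0 C0 Kbd]]]] p2 C3 a0.
move=> theta v th0 hth.
have [q pE] : exists q, p = q + 2 by exists (p - 2); rewrite subrK.
have q0 : 0 < q by lra.
subst p; set e := (fun i => eps i : T -> R) in stat C3 *.
have meps i : measurable_fun setT (e i) by exact: measurable_funPT.
have e0Lp : inLp P q (e 0) by apply: Lnorm_lty_inLp => //; case: C3.
have eLp i : inLp P q (e i) by exact: eps_inLp.
have emom i : moment P q (e i) = moment P q (e 0) by exact: moment_eps.
have ecent i : (\int[P]_w (e i w)%:E = 0)%E.
  by rewrite stationary_mean//; move: E0; rewrite unlock.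
have [D D0 momD] := moment_inequality q0 meps stat e0Lp C3.
(* The value of [dyadic_const] in [block_bound]. *)
pose L : R := 2 `^ (q + 2)^-1 / (2 `^ 2^-1 - 2 `^ (q + 2)^-1).
have L0 : 0 <= L.
  rewrite divr_ge0 ?powR_ge0// subr_ge0 ler_powR ?ler1n// lef_pV2 ?posrE//; lra.
pose B := (D * C ^+ 2) `^ 2^-1; pose m := moment P q (e 0) `^ (q + 2)^-1.
(* The constant of [deviation_bound], built from quantities that do not involve [n]. *)
exists (c^-1 * 2 ^+ d * ((3 ^+ d) `^ (q + 2)^-1 * B * (2 * (L * 12 `^ 2^-1)) ^+ d + eta * m)).
near=> n.
have n0 : (0 < n)%N by near: n; exact: nbhs_infty_gt.
have h1 : h n <= 2^-1.
  by near: n; apply: cvgr_le hcv _ _; rewrite invr_gt0.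
have nh1 : 1 <= n%:R * h n by near: n; move/cvgryPge : nhcv; apply.
have nR1 : 1 <= n%:R :> R by rewrite ler1n.
pose z : R := n%:R `^ (a * (q + 2) / d%:R).
have z1 : 1 <= z.
  rewrite -(powRr0 n%:R) /z; apply: ler_powR => //.
  by rewrite divr_ge0 ?mulr_ge0 ?(ltW a0)//; lra.
(* The least integer above [z = n^(ap/d)]; [z >= 1] gives [M + 1 <= z + 2 <= 3 z]. *)
pose M := (Num.trunc z).+1.
have /andP[tz1 tz2] := truncn_itv (le_trans ler01 z1).
have Mup : M.+1%:R <= 3 * z by rewrite /M -!natr1; lra.
have [N [Nlow Nup]] := dyadic_size nh1.
have Mlow : z <= M%:R by exact: ltW.
have Mh := mesh_le_bandwidth d1 a0 p2 erefl n0 (hth n n0) Mlow.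
apply: le_trans (Lnorm_sup_dev_le q0 eLp emom ecent D0 momD K0 Ksupp eta0 Klip c0 Kbd
  n0 (h0 n) g (isT : (0 < M)%N) Mh Nlow h1 nh1) _.
have B0 : 0 <= B by exact: powR_ge0.
have m0 : 0 <= m by exact: powR_ge0.
rewrite lee_fin.
exact: (deviation_bound d1 p2 erefl th0 n0 nh1 (h0 n) (hth n n0) Mlow Mup Nup B0 L0 m0 eta0 c0).
Unshelve. all: by end_near. Qed.
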